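(* Let $G$ be a circular-arc graph (with a fixed arc representation) and let $\varrho(G)$ be as defined in the context, and let $\delta(G)$ denote its hyperbolicity constant. If $\varrho(G)\neq 1,2$, then $$\frac14\,\varrho(G)\le \delta(G)\le \frac12\Big\lfloor \frac12\,\varrho(G)\Big\rfloor+\frac32 .$$ If $\varrho(G)=1$, then $0\le \delta(G)\le \frac32$. If $\varrho(G)=2$, then $0\le\delta(G)\le 2$. Moreover, all these inequalities are sharp.
   Context: Graphs are simple, possibly infinite, with every edge of length $1$. A graph $G$ is regarded as a metric space by identifying each edge isometrically with $[0,1]$ (so points of $G$ are vertices and interior points of edges), with $d_G$ the induced shortest-path distance ($d_G=\infty$ between different components). A geodesic triangle $T=\{x,y,z\}$ is a union of three geodesics $[xy],[yz],[zx]$; $T$ is $\delta$-thin if each side lies in the $\delta$-neighborhood of the union of the other two sides, and $\delta(T)$ is the infimum of such $\delta$. For connected $G$, $\delta(G)=\sup\{\delta(T): T$ a geodesic triangle in $G\}$; for disconnected $G$, $\delta(G)$ is the supremum of $\delta$ over its connected components. A circular-arc graph $G$ is given by a family of arcs $\{I_v\}_{v\in V(G)}$ of the unit circle $\mathbb{S}^1$, with distinct $u,v$ adjacent iff $I_u\cap I_v\neq\emptyset$. A finite set $K$ of vertices is total if $\bigcup_{v\in K} I_v=\mathbb{S}^1$; its size is $|K|$. $\varrho(G)$ is the minimum size of a total set of vertices, and $\varrho(G):=0$ if $G$ has no total set (in which case $G$ is an interval graph). $\lfloor t\rfloor$ denotes the integer part.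
   Formalization: The arcs of the representation are taken nondegenerate and either all closed or all open, since the bound fails for half-open or mixed arcs (four disjoint half-open quarter circles have ϱ=4 and δ=0); the graph is taken nonempty. *)

(* Defs.v *)
From HB Require Import structures.
From mathcomp Require Import all_boot all_order all_algebra.
From mathcomp Require Import all_classical all_reals all_analysis.

Set Implicit Arguments.
Unset Strict Implicit.
Unset Printing Implicit Defensive.

Import Order.TTheory GRing.Theory Num.Theory.

Local Open Scope classical_set_scope.
Local Open Scope ring_scope.

(* A point of the metric graph is encoded by its barycentric coordinates, a
   function V -> R: the vertex v is the indicator function of v, and the point
   at distance t from u on the edge uv is (1 - t) u + t v. This makes the
   identifications (u, v, t) ~ (v, u, 1 - t) and (u, v, 0) ~ u hold as equalities. *)
Section MetricGraph.
Context {R : realType} {V : Type} (adj : V -> V -> Prop).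

Definition vertex_point (v : V) : V -> R := \1_[set v].

Definition edge_point (u v : V) (t : R) : V -> R :=
  fun w => (1 - t) * vertex_point u w + t * vertex_point v w.

Definition graph_points : set (V -> R) :=
  [set x | (exists v, x = vertex_point v) \/
           (exists u v t, [/\ adj u v, 0 <= t <= 1 & x = edge_point u v t])].

Definition edge_step (x y : V -> R) (l : R) : Prop :=
  exists u v s t, [/\ adj u v, 0 <= s <= 1, 0 <= t <= 1 &
    [/\ x = edge_point u v s, y = edge_point u v t & l = `|s - t|]].

Definition chain_length (x y : V -> R) (l : R) : Prop :=
  exists (n : nat) (c : nat -> V -> R) (d : nat -> R),
    [/\ c 0%N = x, c n = y,
        forall i, (i < n)%N -> edge_step (c i) (c i.+1) (d i) &
        l = \sum_(i < n) d i].

(* Equal to +oo when no chain joins x to y, as ereal_inf set0 = +oo. *)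
Definition graph_dist (x y : V -> R) : \bar R :=
  ereal_inf [set l%:E | l in chain_length x y].

Definition geodesic (A : set (V -> R)) (x y : V -> R) : Prop :=
  exists (L : R) (g : R -> V -> R),
    [/\ 0 <= L, g 0 = x, g L = y & A = g @` `[0, L]] /\
    [/\ forall s, 0 <= s <= L -> graph_points (g s) &
        forall s t, 0 <= s <= L -> 0 <= t <= L ->
          graph_dist (g s) (g t) = `|s - t|%:E].

Definition dist_to_set (x : V -> R) (A : set (V -> R)) : \bar R :=
  ereal_inf [set graph_dist x y | y in A].

Definition in_nbhd (r : R) (A B : set (V -> R)) : Prop :=
  forall x, A x -> (dist_to_set x B <= r%:E)%E.

Definition geodesic_triangle (A B C : set (V -> R)) : Prop :=
  exists x y z, [/\ geodesic A x y, geodesic B y z & geodesic C z x].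

Definition thin (r : R) (A B C : set (V -> R)) : Prop :=
  [/\ in_nbhd r A (B `|` C), in_nbhd r B (C `|` A) & in_nbhd r C (A `|` B)].

Definition triangle_delta (A B C : set (V -> R)) : \bar R :=
  ereal_inf [set r%:E | r in [set r : R | 0 <= r /\ thin r A B C]].

Definition component (x : V -> R) : set (V -> R) :=
  [set y | graph_points y /\ (graph_dist x y < +oo)%E].

Definition component_delta (X : set (V -> R)) : \bar R :=
  ereal_sup [set d | exists A B C,
    [/\ geodesic_triangle A B C, A `|` B `|` C `<=` X &
        d = triangle_delta A B C]].

Definition hyperbolicity : \bar R :=
  ereal_sup [set component_delta (component x) | x in graph_points].

End MetricGraph.

Section Circle.
Context {R : realType}.

Definition circle : set (R * R) := [set z | z.1 ^+ 2 + z.2 ^+ 2 = 1].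

Definition angle_point (t : R) : R * R := (cos t, sin t).

(* The whole circle is an arc, of either kind: take b - a large. *)
Definition closed_arc (A : set (R * R)) : Prop :=
  exists a b : R, a < b /\ A = angle_point @` `[a, b].

Definition open_arc (A : set (R * R)) : Prop :=
  exists a b : R, a < b /\ A = angle_point @` `]a, b[.

End Circle.

(* The arcs are uniformly closed or uniformly open: mixing both kinds would
   allow pairwise disjoint arcs to cover the circle. *)
Record circular_arc_graph (R : realType) := CircularArcGraph {
  vertex : Type;
  arc : vertex -> set (R * R);
  vertex_nonempty : inhabited vertex;
  arcP : (forall v, closed_arc (arc v)) \/ (forall v, open_arc (arc v))
}.

Section CircularArcGraph.
Context {R : realType} (G : circular_arc_graph R).

Definition arc_adj (u v : vertex G) : Prop :=
  u <> v /\ arc u `&` arc v !=set0.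

Definition total_set (K : set (vertex G)) : Prop :=
  finite_set K /\ \bigcup_(v in K) arc v = circle.

Definition has_total_of_size (n : nat) : Prop :=
  exists K : set (vertex G), total_set K /\ (K #= `I_n)%card.

Definition varrho : nat :=
  if pselect (exists n, `[< has_total_of_size n >]) is left h
  then ex_minn h else 0%N.

Definition delta : \bar R := hyperbolicity arc_adj.

End CircularArcGraph.

(* Main.v *)
(** Any point of a side of a geodesic triangle is within half the diameter of a
vertex of the triangle, so the hyperbolicity constant is at most half the
diameter. Every arc meets an arc of a minimum total set, whose arcs form a cycle
of length [rho]; hence the vertices are at distance at most [floor (rho / 2) + 2],
and the points at distance at most [floor (rho / 2) + 3].

For the lower bound, lift the arcs to the real line. A closed walk that lifts to
a walk between two different translates of the same arc covers the circle, so it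
has at least [rho] steps. Following the lifts greedily to the right through a
minimum total set gives such a walk with exactly [rho] steps, and a shortcut
between two of its vertices would close up to a shorter one. The cycle is thus
isometric, and it contains a geodesic bigon of thinness [rho / 4].

Without a total set, let [p] be a point of a side that is far from the other two,
[x] and [y] the ends of this side, and [w] a vertex nearest to [p]. The other two
sides join [x] to [y] outside the closed neighbourhood of [w], and every path from
[x] or [y] to [p] enters this neighbourhood through a vertex adjacent to that outer
region. Such vertices are pairwise adjacent, since in the line they all bridge the
same gap; going from one to another is then shorter than going through [p], which
is absurd.

Tilings of the circle by [rho] arcs attain the lower bound. For [rho > 0] the upper
one is attained by superposing on a tiling by [rho] arcs a finer one, by
[2 floor (rho / 2) + 6] arcs. *)

Require Import Defs.
From HB Require Import structures.
From mathcomp Require Import all_boot all_order all_algebra.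
From mathcomp Require Import all_classical all_reals all_analysis.
From mathcomp Require Import zify ring lra.

Set Implicit Arguments.
Unset Strict Implicit.
Unset Printing Implicit Defensive.

Import Order.TTheory GRing.Theory Num.Theory.

Local Open Scope classical_set_scope.
Local Open Scope ring_scope.

(** * Walks of a given length along a relation *)

Fixpoint walk (T : Type) (r : T -> T -> Prop) (k : nat) (a b : T) : Prop :=
  if k is k'.+1 then exists2 c, r a c & walk r k' c b else a = b.

Section Walks.
Variables (T : Type) (r : T -> T -> Prop).

Lemma walk_cat k l a b c : walk r k a b -> walk r l b c -> walk r (k + l) a c.
Proof.
elim: k a => [|k IH] a /=; first by move=> ->.
by case=> d rad wdb wbc; exists d => //; apply: IH.
Qed.

Lemma walk_rcons k a b c : walk r k a b -> r b c -> walk r k.+1 a c.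
Proof. by move=> wab rbc; rewrite -addn1; apply: walk_cat wab _; exists c. Qed.

Lemma walk_sym k a b : (forall x y, r x y -> r y x) ->
  walk r k a b -> walk r k b a.
Proof.
move=> rC; elim: k a b => [|k IH] a b /=; first by move=> ->.
by case=> c rac wcb; apply: walk_rcons (rC _ _ rac); apply: IH.
Qed.

Lemma walk_seq (c : nat -> T) i k :
  (forall j, (i <= j < i + k)%N -> r (c j) (c j.+1)) ->
  walk r k (c i) (c (i + k)%N).
Proof.
elim: k i => [|k IH] i rc /=; first by rewrite addn0.
exists (c i.+1); first by apply: rc; lia.
by rewrite addnS -addSn; apply: IH => j ?; apply: rc; lia.
Qed.

Lemma walkP k a b : walk r k a b -> exists c : nat -> T,
  [/\ c 0%N = a, c k = b & forall i, (i < k)%N -> r (c i) (c i.+1)].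
Proof.
elim: k a => [|k IH] a /=; first by move=> ->; exists (fun=> b).
case=> d rad /IH[c [c0 ck rc]].
exists (fun i => if i is i'.+1 then c i' else a); split=> // -[|i] ik.
  by rewrite c0.
exact: rc.
Qed.

(** Turns an integer potential that grows by at most [e] per step into a lower bound for the length
    of a walk. *)
Lemma walk_le (phi : T -> int) (e : int) k a b :
  (forall x y, r x y -> phi y <= phi x + e) ->
  walk r k a b -> phi b <= phi a + e * k%:Z.
Proof.
move=> lip; elim: k a => [|k IH] a /=; first by move=> ->; lia.
by case=> c /lip h1 /IH h2; lia.
Qed.

Lemma walk_homo k a b (r' : T -> T -> Prop) :
  (forall x y, r x y -> r' x y) -> walk r k a b -> walk r' k a b.
Proof.
move=> rr'; elim: k a => [|k IH] a //=.
by case=> c /rr' h /IH; exists c.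
Qed.

End Walks.

(** * The metric graph *)

Section MetricGraphTheory.
Context {R : realType} {V : Type} (adj : V -> V -> Prop).
Context (adjC : forall u v, adj u v -> adj v u).
Context (adjN : forall u v, adj u v -> u <> v).

Local Notation pt := (V -> R).
Local Notation vtx := (@vertex_point R V).
Local Notation ep := (@edge_point R V).
Local Notation dist := (@graph_dist R V adj).
Local Notation step := (@edge_step R V adj).
Local Notation points := (@graph_points R V adj).
Implicit Types (x y z p q : pt) (l r s t e tau : R) (u v w : V).

Lemma vtx1 u : vtx u u = 1.
Proof. by rewrite /vertex_point indicE mem_set. Qed.

Lemma vtx0 u w : w <> u -> vtx u w = 0.
Proof. by move=> h; rewrite /vertex_point indicE memNset. Qed.

Lemma edge_pointl u v t : u <> v -> ep u v t u = 1 - t.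
Proof. by move=> uv; rewrite /edge_point vtx1 vtx0// mulr0 addr0 mulr1. Qed.

Lemma edge_pointr u v t : u <> v -> ep u v t v = t.
Proof.
by move=> uv; rewrite /edge_point vtx1 vtx0 ?mulr0 ?add0r ?mulr1//; apply/nesym.
Qed.

Lemma edge_point_out u v t w : w <> u -> w <> v -> ep u v t w = 0.
Proof. by move=> wu wv; rewrite /edge_point !vtx0// !mulr0 addr0. Qed.

Lemma edge_point_supp u v t w : ep u v t w <> 0 -> w = u \/ w = v.
Proof.
move=> h; have [->|wu] := pselect (w = u); first by left.
by right; apply: contrapT => wv; apply: h; rewrite edge_point_out.
Qed.

Lemma edge_point0 u v : ep u v 0 = vtx u.
Proof. by apply: funext => w; rewrite /edge_point subr0 mul1r mul0r addr0. Qed.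

Lemma edge_point1 u v : ep u v 1 = vtx v.
Proof. by apply: funext => w; rewrite /edge_point subrr mul0r mul1r add0r. Qed.

Lemma edge_pointC u v t : ep u v t = ep v u (1 - t).
Proof. by apply: funext => w; rewrite /edge_point; ring. Qed.

Lemma vertex_pointP v : points (vtx v).
Proof. by left; exists v. Qed.

Lemma edge_pointP u v t : adj u v -> 0 <= t <= 1 -> points (ep u v t).
Proof. by move=> uv t01; right; exists u, v, t. Qed.

(** * Chains and real upper bounds for the distance *)

Inductive chain : pt -> pt -> R -> Prop :=
| chain0 x : chain x x 0
| chainS x y z l l' : step x y l -> chain y z l' -> chain x z (l + l').

Lemma chainP x y l : chain x y l <-> chain_length adj x y l.
Proof.
split.
  elim=> {x y l} [x|x y z l l' sxy _ [n [c [d [c0 cn cd ->]]]]].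
    by exists 0%N, (fun=> x), (fun=> 0); split => //; rewrite big_ord0.
  exists n.+1, (fun i => if i is i'.+1 then c i' else x),
    (fun i => if i is i'.+1 then d i' else l).
  split=> //; last by rewrite big_ord_recl.
  by move=> [|i] ni; [rewrite c0 | apply: cd].
case=> n [c [d [<- <- cd ->]]] {x y l}.
elim: n c d cd => [|n IH] c d cd; first by rewrite big_ord0; exact: chain0.
rewrite big_ord_recl; apply: chainS; first exact: cd.
by apply: (IH (fun i => c i.+1) (fun i => d i.+1)) => i ni; apply: cd.
Qed.

Lemma step_sym x y l : step x y l -> step y x l.
Proof.
case=> u [v [s [t [uv s01 t01 [-> -> ->]]]]].
by exists u, v, t, s; split=> //; split=> //; rewrite distrC.
Qed.

Lemma step_ge0 x y l : step x y l -> 0 <= l.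
Proof. by case=> u [v [s [t [_ _ _ [_ _ ->]]]]]. Qed.

Lemma chain_ge0 x y l : chain x y l -> 0 <= l.
Proof. by elim=> // {}x {}y z {}l l' /step_ge0 h1 _ h2; rewrite addr_ge0. Qed.

Lemma chain_cat x y z l l' : chain x y l -> chain y z l' -> chain x z (l + l').
Proof.
move=> cxy; elim: cxy z l' => {x y l} [x z l'|x y z l l' sxy _ IH w l'' czw].
  by rewrite add0r.
by rewrite -addrA; apply: chainS sxy _; apply: IH.
Qed.

Lemma chain1 x y l : step x y l -> chain x y l.
Proof. by move=> s; rewrite -[l]addr0; apply: chainS s _; apply: chain0. Qed.

Lemma chain_sym x y l : chain x y l -> chain y x l.
Proof.
elim=> {x y l} [x|x y z l l' sxy _ IH]; first exact: chain0.
by rewrite addrC; apply: chain_cat IH _; apply: chain1; apply: step_sym.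
Qed.

(** Real upper bounds of the extended distance keep the triangle inequality free of infinite
    values. *)
Definition dle x y (l : R) := (dist x y <= l%:E)%E.

Lemma dleP x y l :
  dle x y l <-> forall e, 0 < e -> exists2 l', chain x y l' & l' < l + e.
Proof.
split=> [dxy e e0|h].
  have : (dist x y < (l + e)%:E)%E.
    by apply: le_lt_trans dxy _; rewrite lte_fin ltrDl.
  move=> /ereal_inf_lt[_ [l' /chainP cl' <-]]; rewrite lte_fin => ll'.
  by exists l'.
apply/lee_addgt0Pr => e e0; have [l' cl' ll'] := h _ e0.
apply: ge_ereal_inf; exists l'%:E; first by exists l' => //; apply/chainP.
by rewrite -EFinD lee_fin ltW.
Qed.

Lemma chain_dle x y l : chain x y l -> dle x y l.
Proof. by move=> c; apply/dleP => e e0; exists l => //; rewrite ltrDl. Qed.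

Lemma dlexx x : dle x x 0.
Proof. by apply: chain_dle; apply: chain0. Qed.

Lemma dle_sym x y l : dle x y l -> dle y x l.
Proof.
by move=> /dleP h; apply/dleP => e /h[l' /chain_sym ? ?]; exists l'.
Qed.

Lemma dle_trans y x z l l' : dle x y l -> dle y z l' -> dle x z (l + l').
Proof.
move=> /dleP h /dleP h'; apply/dleP => e e0.
have e2 : 0 < e / 2 by lra.
have [a ca la] := h _ e2; have [b cb lb] := h' _ e2.
by exists (a + b); [apply: chain_cat ca cb | lra].
Qed.

Lemma dle_le x y l l' : dle x y l -> l <= l' -> dle x y l'.
Proof. by move=> h ll'; apply: le_trans h _; rewrite lee_fin. Qed.

Lemma dist_ge0 (x y : pt) : (0 <= dist x y)%E.
Proof.
apply: le_ereal_inf_tmp => _ [l /chainP /chain_ge0 l0 <-].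
by rewrite lee_fin.
Qed.

Lemma dle_ge0 x y l : dle x y l -> 0 <= l.
Proof. by move=> /(le_trans (dist_ge0 x y)); rewrite lee_fin. Qed.

Lemma distC x y : dist x y = dist y x.
Proof.
by congr ereal_inf; apply/seteqP; split=> _ [l /chainP/chain_sym/chainP c <-];
  exists l.
Qed.

Lemma dist_eqP x y l :
  dle x y l -> (forall l', chain x y l' -> l <= l') -> dist x y = l%:E.
Proof.
move=> h h'; apply/le_anti/andP; split=> //.
apply: le_ereal_inf_tmp => _ [l' /chainP /h' ll' <-]; by rewrite lee_fin.
Qed.

Lemma dle_dist_ge x y l l' : (l%:E <= dist x y)%E -> dle x y l' -> l <= l'.
Proof. by move=> h /(le_trans h); rewrite lee_fin. Qed.

Lemma dist_geP x y l :
  (forall l', dle x y l' -> l <= l') -> (l%:E <= dist x y)%E.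
Proof.
move=> h; apply: le_ereal_inf_tmp => _ [l' /chainP /chain_dle /h ll' <-].
by rewrite lee_fin.
Qed.

Lemma dle_edge u v s t : adj u v -> 0 <= s <= 1 -> 0 <= t <= 1 ->
  dle (ep u v s) (ep u v t) `|s - t|.
Proof.
move=> uv s01 t01; apply: chain_dle; apply: chain1.
by exists u, v, s, t; split.
Qed.

Lemma dle_edgel u v t : adj u v -> 0 <= t <= 1 -> dle (ep u v t) (vtx u) t.
Proof.
move=> uv t01; rewrite -(edge_point0 u v).
have /= := @dle_edge u v t 0 uv t01; rewrite lexx ler01 subr0 => /(_ isT).
by rewrite ger0_norm//; lra.
Qed.

Lemma dle_adj u v : adj u v -> dle (vtx u) (vtx v) 1.
Proof.
move=> uv; have := @dle_edgel v u 1 (adjC uv).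
by rewrite edge_point1 ler01 lexx; apply.
Qed.

Lemma walk_dle k u v : walk adj k u v -> dle (vtx u) (vtx v) k%:R.
Proof.
elim: k u => [|k IH] u /=; first by move=> ->; exact: dlexx.
by case=> w /dle_adj uw /IH wv; rewrite -addn1 natrD addrC; apply: dle_trans wv.
Qed.

(** An edge step from [s] to [t] changes only the coordinates of the two ends, each by [|s - t|]; so
    every barycentric coordinate is 1-Lipschitz. *)
Lemma chain_coord x y l w : chain x y l -> `|x w - y w| <= l.
Proof.
elim=> {x y l} [x|x y z l l' sxy _ h]; first by rewrite subrr normr0.
have {sxy} : `|x w - y w| <= l; last first.
  move=> h'; rewrite -(subrKA (y w)).
  by apply: le_trans (ler_normD _ _) _; apply: lerD.
case: sxy => u [v [s [t [/adjN uv s01 t01 [-> -> ->]]]]].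
have [->|wu] := pselect (w = u).
  rewrite !edge_pointl//; have -> : 1 - s - (1 - t) = t - s by ring.
  by rewrite distrC.
have [->|wv] := pselect (w = v); first by rewrite !edge_pointr.
by rewrite !edge_point_out// subrr normr0.
Qed.

Lemma dle_coord x y l w : dle x y l -> `|x w - y w| <= l.
Proof.
move=> /dleP h; apply/ler_addgt0Pr => e /h[l' /(@chain_coord _ _ _ w) c ll'].
by apply: le_trans c _; apply: ltW.
Qed.

Lemma near_vertex p : points p -> exists w, p = vtx w \/
  exists w' t, [/\ adj w w', 0 <= t <= 1/2 & p = ep w w' t].
Proof.
case=> [[w ->]|[u [v [t [uv t01 ->]]]]]; first by exists w; left.
have [tle|tgt] := leP t (1/2).
  by exists u; right; exists v, t; split=> //; lra.
exists v; right; exists u, (1 - t); split; [exact: adjC|lra|exact: edge_pointC].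
Qed.

Lemma near_vertex_dle p : points p -> exists w, dle p (vtx w) (1/2).
Proof.
move=> /near_vertex[w [->|[w' [t [ww' t12 ->]]]]]; exists w.
  by apply: dle_le (dlexx _) _; lra.
by refine (dle_le (dle_edgel ww' _) _); lra.
Qed.

(** Each point is within [1/2] of a vertex, which costs [1] for the two points together. *)
Lemma points_diam (D : nat) :
  (forall u v, exists2 k, (k <= D)%N & walk adj k u v) ->
  forall x y, points x -> points y -> dle x y (D%:R + 1).
Proof.
move=> h x y /near_vertex_dle[u xu] /near_vertex_dle[v /dle_sym vy].
have [k kD /walk_dle uv] := h u v.
refine (dle_le (dle_trans xu (dle_trans uv vy)) _).
have : (k%:R : R) <= D%:R by rewrite ler_nat.
lra.
Qed.

(** * Geodesics and bounds on the hyperbolicity constant *)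

Lemma geodesicP A x y : geodesic adj A x y -> exists L,
  [/\ 0 <= L, dist x y = L%:E, A x, A y & forall p, A p ->
    points p /\ exists s, [/\ 0 <= s <= L, dle x p s & dle p y (L - s)]].
Proof.
case=> L [g [[L0 g0 gL ->] [gP gd]]]; exists L.
have L00 : (0 : R) <= (0 : R) <= L by lra.
have LL : 0 <= L <= L by lra.
split=> //.
- by rewrite -g0 -gL gd// sub0r normrN ger0_norm.
- by exists 0; rewrite //= in_itv /=.
- by exists L; rewrite //= in_itv /=.
- move=> p [s]; rewrite /= in_itv /= => sL <-; split; first exact: gP.
  exists s; split=> //.
    by rewrite /dle -g0 gd// sub0r normrN ger0_norm//; case/andP: sL.
  by rewrite /dle -gL gd// distrC ger0_norm// subr_ge0; case/andP: sL.
Qed.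

Lemma dist_to_set_le p q (B : set pt) l : B q -> dle p q l ->
  (dist_to_set adj p B <= l%:E)%E.
Proof. by move=> Bq pq; apply: ge_ereal_inf; exists (dist p q) => //; exists q. Qed.

Lemma hyperbolicity_le (r : R) : 0 <= r ->
  (forall A B C x y z p, geodesic adj A x y -> geodesic adj B y z ->
    geodesic adj C z x -> A p -> (dist_to_set adj p (B `|` C) <= r%:E)%E) ->
  (hyperbolicity (R := R) adj <= r%:E)%E.
Proof.
move=> r0 h; apply: ge_ereal_sup => _ [x _ <-].
apply: ge_ereal_sup => _ [A [B [C [[a [b [c [gA gB gC]]]] _ ->]]]].
apply: ge_ereal_inf; exists r%:E => //; exists r => //; split=> //.
split=> p.
- exact: h gA gB gC.
- exact: h gB gC gA.
- exact: h gC gA gB.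
Qed.

(** The point [p] forces the thinness of the triangle up to [r]; the rest checks that the triangle
    lies in one component, its points being at finite distance from [x]. *)
Lemma hyperbolicity_ge (r : R) A B C x y z p : geodesic adj A x y ->
  geodesic adj B y z -> geodesic adj C z x -> A p ->
  (forall q, (B `|` C) q -> (r%:E <= dist p q)%E) ->
  (r%:E <= hyperbolicity (R := R) adj)%E.
Proof.
move=> gA gB gC Ap h.
have [L [_ dxy Ax Ay PA]] := geodesicP gA.
have [LB [_ _ _ _ PB]] := geodesicP gB.
have [LC [_ _ _ Cx PC]] := geodesicP gC.
have px : points x := (PA _ Ax).1.
have cmp q l : points q -> dle x q l -> component adj x q.
  by move=> pq xq; split=> //; apply: le_lt_trans xq (ltry _).
apply: (@le_trans _ _ (component_delta adj (component adj x))); last first.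
  by apply: ereal_sup_ubound; exists x.
apply: (@le_trans _ _ (triangle_delta adj A B C)); last first.
  apply: ereal_sup_ubound; exists A, B, C; split=> //; first by exists x, y, z.
  move=> q [[/PA[pq [s [_ xq _]]]|/PB[pq [s [_ yq _]]]]|/PC[pq [s [_ _ qx]]]].
  - exact: cmp pq xq.
  - by apply: (cmp _ _ pq); apply: dle_trans yq; rewrite /dle dxy.
  - exact: cmp pq (dle_sym qx).
apply: le_ereal_inf_tmp => _ [r' [r'0 [/(_ _ Ap) thA _ _]] <-].
apply: le_trans thA; apply: le_ereal_inf_tmp => _ [q /h hq <-] //.
Qed.

Lemma hyperbolicity_le_half_diam (D : R) : 0 <= D ->
  (forall x y, points x -> points y -> dle x y D) ->
  (hyperbolicity (R := R) adj <= (D / 2)%:E)%E.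
Proof.
move=> D0 diam; apply: hyperbolicity_le; first by lra.
move=> A B C x y z p /geodesicP[L [L0 dxy Ax Ay PA]].
move=> /geodesicP[_ [_ _ By _ _]] /geodesicP[_ [_ _ _ Cx _]] Ap.
have [_ [s [sL xp py]]] := PA p Ap.
have LD : L <= D.
  by have := diam _ _ (PA _ Ax).1 (PA _ Ay).1; rewrite /dle dxy lee_fin.
have [sD|sD] := leP s (D / 2).
  apply: (@dist_to_set_le p x); first by right.
  by apply: dle_le sD; apply: dle_sym.
by apply: (@dist_to_set_le p y); [left | apply: dle_le py _; lra].
Qed.

Lemma hyperbolicity_ge0 : inhabited V -> (0%:E <= hyperbolicity (R := R) adj)%E.
Proof.
case=> v.
(* A triangle reduced to one vertex shows that the supremum is not taken over an empty set. *)
have g0 : geodesic adj [set vtx v] (vtx v) (vtx v).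
  exists 0, (fun=> vtx v); split; split=> //.
  - apply/seteqP; split=> [_ ->|_ [s _ <-]//].
    by exists 0 => //; rewrite /= in_itv /= lexx.
  - by move=> s _; apply: vertex_pointP.
  - move=> s t s0 t0; have [-> ->] : s = 0 /\ t = 0 by lra.
    rewrite subrr normr0; apply: dist_eqP; first exact: dlexx.
    by move=> l' /chain_ge0.
by apply: (hyperbolicity_ge g0 g0 g0 erefl) => q _; apply: dist_ge0.
Qed.

(* Inside the edge [uv] carrying [p] the distance is read off directly; outside
   of it, every chain from [p] leaves through [u] or [v] and then has to follow
   a walk of vertices, the last of which carries [q]. *)
Lemma dist_edge_ge u v tau q (l0 : R) : adj u v -> 0 <= tau <= 1 ->
  (forall k a, walk adj k u a -> 0 < q a -> l0 <= tau + k%:R + (1 - q a)) ->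
  (forall k a, walk adj k v a -> 0 < q a -> l0 <= 1 - tau + k%:R + (1 - q a)) ->
  (exists2 a, 0 < q a & a <> u /\ a <> v) ->
  (l0%:E <= dist (ep u v tau) q)%E.
Proof.
move=> uv tau01 hu hv [a0 qa0 [a0u a0v]].
(* Invariant of a chain of length [l] from the base point to [z]: either it has left through [u] or
   through [v], and [z] is on an edge at the end [a] of a walk, or [z] is still on the edge [uv]. *)
pose reach z l := (exists k a, [/\ 0 < z a, walk adj k u a &
      tau + k%:R + (1 - z a) <= l]) \/
    (exists k a, [/\ 0 < z a, walk adj k v a &
      1 - tau + k%:R + (1 - z a) <= l]) \/
    exists t, [/\ 0 <= t <= 1, z = ep u v t & `|tau - t| <= l].
have base z : forall l, (exists t, [/\ 0 <= t <= 1, z = ep u v t & `|tau - t| <= l]) ->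
    reach z l.
  by move=> l h; right; right.
(* Moving away from [a'] along an edge keeps the same walk until the other end is hit, where the
   walk gains one step. *)
have move_on a' b' s t k c l : adj a' b' -> 0 <= s <= 1 -> 0 <= t <= 1 ->
    walk adj k c a' -> forall e : R, e + k%:R + (1 - ep a' b' s a') <= l ->
    exists k' a, [/\ 0 < ep a' b' t a, walk adj k' c a &
      e + k'%:R + (1 - ep a' b' t a) <= l + `|s - t|].
  move=> a'b' s01 t01 w e; rewrite edge_pointl; last exact: adjN.
  move=> el; have [t1|t1] := ltP t 1.
    exists k, a'; rewrite edge_pointl; last exact: adjN.
    split=> //; first lra.
    have := ler_norm (t - s); rewrite distrC; lra.
  have {}t1 : t = 1 by lra.
  exists k.+1, b'; rewrite edge_pointr ?t1; last exact: adjN.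
  split=> //; first exact: walk_rcons w a'b'.
  rewrite -addn1 natrD.
  have := ler_norm (1 - s); rewrite distrC; lra.
(* The recorded vertex may be either end of the edge, so the previous fact is applied to the edge or
   to its reverse. *)
have flip a' b' s t k c l a : adj a' b' -> 0 <= s <= 1 -> 0 <= t <= 1 ->
    0 < ep a' b' s a ->
    walk adj k c a -> forall e : R, e + k%:R + (1 - ep a' b' s a) <= l ->
    exists k' a, [/\ 0 < ep a' b' t a, walk adj k' c a &
      e + k'%:R + (1 - ep a' b' t a) <= l + `|s - t|].
  move=> a'b' s01 t01 pa w e el.
  have : a = a' \/ a = b' by apply: (@edge_point_supp a' b' s); lra.
  case=> ?; subst a; first exact: move_on a'b' s01 t01 w e el.
  rewrite (edge_pointC a' b' t).
  have -> : `|s - t| = `|(1 - s) - (1 - t)|.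
    by rewrite distrC; congr `|_|; ring.
  apply: (move_on b' a' (1 - s) (1 - t) k c l (adjC a'b') _ _ w e); [lra|lra|].
  by rewrite -edge_pointC.
have vtx_reach : forall z l, (exists t, [/\ 0 <= t <= 1, z = ep u v t & `|tau - t| <= l]) ->
    z = vtx u \/ z = vtx v ->
    (exists k a, [/\ 0 < z a, walk adj k u a & tau + k%:R + (1 - z a) <= l]) \/
    (exists k a, [/\ 0 < z a, walk adj k v a & 1 - tau + k%:R + (1 - z a) <= l]).
  move=> z l [t [t01 zt tl]] [zu|zv].
    left; exists 0%N, u; rewrite zu vtx1; split=> //.
    have : t = 0.
      have := congr1 (@^~ v) zt; rewrite zu edge_pointr ?vtx0//; last exact: adjN.
      by apply: nesym; apply: adjN.
    by move=> t0; have := ler_norm (tau - t); lra.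
  right; exists 0%N, v; rewrite zv vtx1; split=> //.
  have : t = 1.
    by have := congr1 (@^~ v) zt; rewrite zv edge_pointr ?vtx1//; apply: adjN.
  by move=> t0; have := ler_norm (t - tau); rewrite distrC; lra.
have step_reach z z' l l' : reach z l -> step z z' l' -> reach z' (l + l').
  move=> rz [a' [b' [s [t [a'b' s01 t01 [zs z't ->]]]]]].
  have cont : (exists k a, [/\ 0 < z a, walk adj k u a & tau + k%:R + (1 - z a) <= l]) \/
    (exists k a, [/\ 0 < z a, walk adj k v a & 1 - tau + k%:R + (1 - z a) <= l]) ->
    reach z' (l + `|s - t|).
    rewrite zs z't; case=> -[k [a [pa w e]]]; [left|right; left];
      exact: flip a'b' s01 t01 pa w _ e.
  case: rz => [h|[h|h]]; [by apply: cont; left|by apply: cont; right|].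
  have [zv|zv] := pselect (z = vtx u \/ z = vtx v).
    by apply: cont; apply: vtx_reach h zv.
  have [t0 [t001 zt0 tl]] := h.
  have t0N0 : t0 <> 0 by move=> t00; apply: zv; left; rewrite zt0 t00 edge_point0.
  have t0N1 : t0 <> 1 by move=> t00; apply: zv; right; rewrite zt0 t00 edge_point1.
  have zu : z u = 1 - t0 by rewrite zt0 edge_pointl//; apply: adjN.
  have zv' : z v = t0 by rewrite zt0 edge_pointr//; apply: adjN.
  (* Here [z] is interior to the edge [uv]: both coordinates are nonzero, so the step runs along
     this very edge. *)
  have uab : u = a' \/ u = b'.
    by apply: (@edge_point_supp a' b' s); rewrite -zs zu; lra.
  have vab : v = a' \/ v = b'.
    by apply: (@edge_point_supp a' b' s); rewrite -zs zv'; lra.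
  have uNv := adjN uv; right; right.
  have {uab vab} [[? ?]|[? ?]] : (a' = u /\ b' = v) \/ (a' = v /\ b' = u).
    by case: uab vab => ua [] va; [case: uNv; rewrite va|left|right|
      case: uNv; rewrite va].
  - subst a' b'; have st0 : s = t0 by rewrite -zv' zs edge_pointr.
    exists t; split=> //; rewrite -(subrKA t0).
    by apply: le_trans (ler_normD _ _) _; rewrite st0; lra.
  - subst a' b'; have st0 : 1 - s = t0 by rewrite -zv' zs edge_pointl//; apply/nesym.
    exists (1 - t); split; [lra|by rewrite z't edge_pointC|].
    rewrite -(subrKA t0); apply: le_trans (ler_normD _ _) _.
    have -> : t0 - (1 - t) = t - s by rewrite -st0; ring.
    by rewrite (distrC s); lra.
have chain_reach x y l l' : chain x y l' -> reach x l -> reach y (l + l').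
  move=> c; elim: c l => {x y l'} [x l|x y z l' l'' sxy _ IH l rx].
    by rewrite addr0.
  by rewrite addrA; apply: IH; apply: step_reach rx sxy.
apply: le_ereal_inf_tmp => _ [l /chainP cl <-]; rewrite lee_fin.
have : reach q (0 + l).
  by apply: chain_reach cl _; apply: base; exists tau; rewrite subrr normr0.
rewrite add0r; case=> [[k [a [qa w]]]|[[k [a [qa w]]]|[t [_ qt _]]]].
- exact/le_trans/hu.
- exact/le_trans/hv.
- by exfalso; have := qa0; rewrite qt edge_point_out// ltxx.
Qed.

(** * Closed walks and geodesic bigons *)

Section ClosedWalk.
Variable c : nat -> V.
Hypothesis c_adj : forall i, adj (c i) (c i.+1).

Definition walk_point (t : R) : pt :=
  ep (c (Num.truncn t)) (c (Num.truncn t).+1) (t - (Num.truncn t)%:R).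

(** At [t = i + 1] the integer part selects the next edge, but both descriptions give the vertex
    [c i.+1]. *)
Lemma walk_pointE t i : i%:R <= t <= i.+1%:R ->
  walk_point t = ep (c i) (c i.+1) (t - i%:R).
Proof.
move=> /andP[it]; rewrite le_eqVlt => /orP[/eqP ->|ti].
  rewrite /walk_point natrK -[in RHS]natrB// subrr subSnn edge_point0 edge_point1 //.
suff -> : i = Num.truncn t by [].
by apply/esym/eqP; rewrite truncn_eq ?it// (le_trans _ it).
Qed.

Lemma walk_point_nat i : walk_point i%:R = vtx (c i).
Proof. by rewrite (@walk_pointE _ i) ?subrr ?edge_point0// lexx ler_nat /=. Qed.

Lemma truncn_bounds t : 0 <= t ->
  (Num.truncn t)%:R <= t < (Num.truncn t)%:R + 1.
Proof. by move=> t0; rewrite natr1; apply: truncn_itv. Qed.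

Lemma walk_point_point t : 0 <= t -> points (walk_point t).
Proof.
by move=> /truncn_bounds t0; apply: edge_pointP; [exact: c_adj|lra].
Qed.

Lemma walk_point_dle_succ i s t : i%:R <= s -> s <= t -> t <= i.+1%:R ->
  dle (walk_point s) (walk_point t) (t - s).
Proof.
move=> si st ti; have i1 : (i.+1%:R : R) = i%:R + 1 by rewrite natr1.
rewrite !(@walk_pointE _ i); try lra.
refine (dle_le (dle_edge (c_adj i) _ _) _); try lra.
by rewrite distrC ger0_norm; lra.
Qed.

Lemma walk_point_dle s t : 0 <= s <= t -> dle (walk_point s) (walk_point t) (t - s).
Proof.
case/andP=> s0 st; have t0 : 0 <= t by lra.
have := truncn_bounds s0; have := truncn_bounds t0.
set j := Num.truncn t; set i := Num.truncn s => jt is_.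
have ij : (i <= j)%N.
  have : (i%:R : R) < j.+1%:R by rewrite -natr1; lra.
  by rewrite ltr_nat.
clearbody i j; have [k jk] : exists k, j = (i + k)%N by exists (j - i)%N; lia.
(* Induction on the number of integers crossed: the path is cut at the first one, [i.+1]. *)
elim: k i s s0 st is_ ij jk => [|k IH] i s s0 st is_ ij jk.
  apply: (@walk_point_dle_succ i) => //; first lra.
  by rewrite -natr1; move: jt; rewrite jk addn0; lra.
have i1 : (i.+1%:R : R) = i%:R + 1 by rewrite natr1.
have i1j : (i.+1%:R : R) <= j%:R by rewrite ler_nat; lia.
have h1 : dle (walk_point s) (walk_point i.+1%:R) (i.+1%:R - s).
  by apply: (@walk_point_dle_succ i s i.+1%:R); rewrite ?lexx; lra.
have h2 : dle (walk_point i.+1%:R) (walk_point t) (t - i.+1%:R).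
  by apply: (IH i.+1 i.+1%:R); [exact: ler0n|lra|lra|lia|lia].
by refine (dle_le (dle_trans h1 h2) _); lra.
Qed.

Lemma walk_point_periodic N t : (forall i, c (i + N)%N = c i) -> 0 <= t ->
  walk_point (t + N%:R) = walk_point t.
Proof.
move=> cN t0; have := truncn_bounds t0; set i := Num.truncn t => it.
rewrite (@walk_pointE _ (i + N)%N).
  by rewrite -addSn !cN natrD /walk_point -/i; congr (ep _ _ _); ring.
by rewrite -addSn !natrD -natr1; lra.
Qed.

Lemma walk_point_supp t a : 0 <= t -> 0 < walk_point t a -> exists j : nat,
  [/\ a = c j, (Num.truncn t <= j <= (Num.truncn t).+1)%N &
      1 - walk_point t a = `|t - j%:R|].
Proof.
move=> /truncn_bounds; rewrite /walk_point; set i := Num.truncn t => it pa.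
have ii := adjN (c_adj i).
have : a = c i \/ a = c i.+1.
  by apply: (@edge_point_supp _ _ (t - i%:R)); lra.
case=> ->; [exists i|exists i.+1]; split=> //.
- lia.
- by rewrite edge_pointl// ger0_norm; lra.
- lia.
- rewrite edge_pointr// -natr1 ler0_norm; lra.
Qed.

Lemma walk_point_val t j : 0 <= t -> `|t - j%:R| < 1 ->
  walk_point t (c j) = 1 - `|t - j%:R|.
Proof.
move=> t0 tj; have := truncn_bounds t0; set i := Num.truncn t => it.
have /orP[/eqP ji|/eqP ji] : (j == i) || (j == i.+1).
- have h1 : (j%:R : R) < i.+2%:R.
    rewrite -addn2 natrD; have := ler_norm (j%:R - t); rewrite distrC; lra.
  have h2 : (i%:R : R) < j.+1%:R.
    rewrite -natr1; have := ler_norm (t - j%:R); lra.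
  move: h1 h2; rewrite !ltr_nat; lia.
- have ii := adjN (c_adj i).
  by rewrite ji /walk_point -/i edge_pointl// ger0_norm; lra.
- have ii := adjN (c_adj i).
  rewrite ji /walk_point -/i edge_pointr// -natr1 ler0_norm; lra.
Qed.

(** A shortcut between two intermediate points would shorten the whole path, so the bound at the
    ends makes every piece isometric. *)
Lemma walk_point_geodesic a b : 0 <= a <= b ->
  (forall l, dle (walk_point a) (walk_point b) l -> b - a <= l) ->
  geodesic adj (walk_point @` `[a, b]) (walk_point a) (walk_point b).
Proof.
move=> ab lb; exists (b - a), (fun s => walk_point (a + s)); split; split.
- lra.
- by rewrite addr0.
- by congr walk_point; ring.
- apply/seteqP; split=> q [s]; rewrite /= in_itv /= => sab <-.
    by exists (s - a); rewrite /= ?in_itv /=; [lra|congr walk_point; ring].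
  by exists (a + s) => //; rewrite /= in_itv /=; lra.
- by move=> s sab; apply: walk_point_point; lra.
- move=> s t.
  wlog st : s t / s <= t.
    move=> h sab tab; have [st|ts] := leP s t; first exact: h.
    by rewrite distC distrC; apply: h => //; apply: ltW.
  move=> sab tab; rewrite distrC ger0_norm; last lra.
  have st' : dle (walk_point (a + s)) (walk_point (a + t)) (t - s).
    by refine (dle_le (walk_point_dle _) _); lra.
  apply: dist_eqP => // l /chain_dle stl.
  have h1 : dle (walk_point a) (walk_point (a + s)) s.
    by refine (dle_le (walk_point_dle _) _); lra.
  have h2 : dle (walk_point (a + t)) (walk_point b) (b - (a + t)).
    by apply: walk_point_dle; lra.
  by have := lb _ (dle_trans (dle_trans h1 stl) h2); lra.
Qed.

(** The two halves of the closed walk form a bigon, completed to a triangle by the constant geodesic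
    at [y]; the midpoint of the first half is at least [N / 4] away from the second. *)
Lemma bigon_hyperbolicity_ge (N : nat) (s0 : R) :
  (forall i, c (i + N)%N = c i) -> 0 <= s0 ->
  (forall l, dle (walk_point s0) (walk_point (s0 + N%:R / 2)) l -> N%:R / 2 <= l) ->
  (forall t l, s0 + N%:R / 2 <= t <= s0 + N%:R ->
     dle (walk_point (s0 + N%:R / 4)) (walk_point t) l -> N%:R / 4 <= l) ->
  ((N%:R / 4)%:E <= hyperbolicity (R := R) adj)%E.
Proof.
move=> cN s00 hxy hp.
have N0 : (0 : R) <= N%:R by rewrite ler0n.
set y := s0 + N%:R / 2.
have gA : geodesic adj (walk_point @` `[s0, y]) (walk_point s0) (walk_point y).
  by apply: walk_point_geodesic => [|l /hxy]; rewrite /y; lra.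
have gB : geodesic adj (walk_point @` `[y, y]) (walk_point y) (walk_point y).
  by apply: walk_point_geodesic => [|l /dle_ge0]; rewrite /y; lra.
have gC : geodesic adj (walk_point @` `[y, s0 + N%:R]) (walk_point y) (walk_point s0).
  rewrite -(walk_point_periodic cN s00).
  apply: walk_point_geodesic => [|l]; first by rewrite /y; lra.
  by rewrite walk_point_periodic// => /dle_sym/hxy; rewrite /y; lra.
apply: (hyperbolicity_ge gA gB gC (p := walk_point (s0 + N%:R / 4))).
  by exists (s0 + N%:R / 4) => //; rewrite /= in_itv /= /y; lra.
move=> q [|] [t]; rewrite /= in_itv /= => ty <-; apply: dist_geP => l;
  apply: hp; move: ty; rewrite /y; lra.
Qed.

(** Every point [t] of the second half is within [N / 4], along the cycle, of the antipode of the
    midpoint; going from the midpoint to [t] and on to this antipode takes at least [N / 2]. *)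
Lemma antipodal_hyperbolicity_ge (N : nat) : (forall i, c (i + N)%N = c i) ->
  (forall s l, 0 <= s -> dle (walk_point s) (walk_point (s + N%:R / 2)) l ->
     N%:R / 2 <= l) ->
  ((N%:R / 4)%:E <= hyperbolicity (R := R) adj)%E.
Proof.
move=> cN anti; have N0 : (0 : R) <= N%:R by rewrite ler0n.
apply: (@bigon_hyperbolicity_ge N 0) => // [l|t l tN]; first exact: anti.
rewrite !add0r in tN * => pt.
have p4 : 0 <= (N%:R / 4 : R) by lra.
have [t34|t34] := leP t (N%:R / 4 + N%:R / 2).
  have := anti _ _ p4 (dle_trans pt (walk_point_dle (t := N%:R / 4 + N%:R / 2) _)).
  by lra.
have : dle (walk_point t) (walk_point (N%:R / 4 + N%:R / 2))
    (t - (N%:R / 4 + N%:R / 2)).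
  by apply: dle_sym; apply: walk_point_dle; lra.
by move=> /(dle_trans pt)/(anti _ _ p4); lra.
Qed.

Lemma walk_point_diam (N : nat) s t : (0 < N)%N -> (forall i, c (i + N)%N = c i) ->
  0 <= s <= N%:R -> 0 <= t <= N%:R -> dle (walk_point s) (walk_point t) (N%:R / 2).
Proof.
move=> N0 cN; wlog st : s t / s <= t.
  move=> h sN tN; have [st|ts] := leP s t; first exact: h.
  by apply: dle_sym; apply: h => //; apply: ltW.
move=> sN tN; have [near|far] := leP (t - s) (N%:R / 2).
  by refine (dle_le (walk_point_dle _) near); lra.
apply: dle_sym; rewrite -(walk_point_periodic cN (t := s)); last lra.
by refine (dle_le (walk_point_dle _) _); lra.
Qed.

End ClosedWalk.

Lemma geodesic_at A x y l s : geodesic adj A x y -> dist x y = l%:E ->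
  0 <= s <= l -> exists2 p, A p & dle x p s /\ dle p y (l - s).
Proof.
case=> L [g [[L0 gx gy ->] [_ gd]]] dxy sl.
have [h0 hL] : (0 : R) <= (0 : R) <= L /\ 0 <= L <= L by split; lra.
have : l%:E = L%:E by rewrite -dxy -gx -gy gd// sub0r normrN ger0_norm.
case=> lL; subst l; exists (g s); first by exists s => //; rewrite /= in_itv.
split; rewrite /dle -?gx -?gy gd//.
  by rewrite sub0r normrN ger0_norm//; lra.
by rewrite distrC ger0_norm//; lra.
Qed.

(** The graph is a single edge, isometric to [[0, 1]] by the coordinate at [b]; a point between [x]
    and [y] lies between [z] and one of them, hence on another side. *)
Lemma segment_hyperbolicity a b : adj a b -> (forall v, v = a \/ v = b) ->
  (hyperbolicity (R := R) adj <= 0%:E)%E.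
Proof.
move=> ab Vab; have aNb := adjN ab.
have ptE x : points x -> 0 <= x b <= 1 /\ x = ep a b (x b).
  case=> [[v ->]|[u [v [t [uv t01 ->]]]]].
    case: (Vab v) => ->; rewrite ?vtx1 ?vtx0 ?edge_point0 ?edge_point1 ?lexx ?ler01//.
    exact/nesym.
  have uNv := adjN uv.
  case: (Vab u) (Vab v) uNv t01 => -> [] -> //= _ t01.
    by rewrite edge_pointr.
  rewrite edge_pointl; last exact/nesym.
  by rewrite [LHS]edge_pointC; split=> //; lra.
have distE x y : points x -> points y -> dist x y = `|x b - y b|%:E.
  move=> /ptE[x01 xE] /ptE[y01 yE]; apply: dist_eqP => [|l' c].
    by rewrite [in X in dle X]xE [in X in dle _ X]yE; apply: dle_edge.
  exact: (chain_coord b c).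
apply: hyperbolicity_le => // A B C x y z p gA gB gC Ap.
have [L [L0 dxy Ax Ay PA]] := geodesicP gA.
have [LB [LB0 dyz _ Bz PB]] := geodesicP gB.
have [LC [LC0 dzx _ _ PC]] := geodesicP gC.
have [pp [s [sL xp py]]] := PA _ Ap.
have px := (PA _ Ax).1; have py' := (PA _ Ay).1; have pz := (PB _ Bz).1.
rewrite (distE _ _ px py') in dxy; rewrite (distE _ _ py' pz) in dyz.
rewrite (distE _ _ pz px) in dzx.
case: dxy dyz dzx => dxy [dyz] [dzx].
have cx := dle_coord b xp; have cy := dle_coord b py.
have on D (u v : pt) : geodesic adj D u v -> points u -> points v ->
    (u b <= p b <= v b) || (v b <= p b <= u b) -> D p.
  move=> gD pu pv btw.
  have abs : u b <= p b <= v b /\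
      (`|u b - p b| = p b - u b /\ `|u b - v b| = v b - u b) \/
      v b <= p b <= u b /\
      (`|u b - p b| = u b - p b /\ `|u b - v b| = u b - v b).
    case/orP: btw => h; [left|right]; split=> //; split.
    - by rewrite ler0_norm; lra.
    - by rewrite ler0_norm; lra.
    - by rewrite ger0_norm; lra.
    - by rewrite ger0_norm; lra.
  have [q Dq [uq qv]] : exists2 q, D q & dle u q `|u b - p b| /\
      dle q v (`|u b - v b| - `|u b - p b|).
    apply: geodesic_at gD (distE _ _ pu pv) _; rewrite normr_ge0 /=.
    by case: abs => -[h [-> ->]]; lra.
  suff -> : p = q by [].
  have pq : points q by have [M [_ _ _ _ h]] := geodesicP gD; have [] := h _ Dq.
  have [_ ->] := ptE _ pp; have [_ ->] := ptE _ pq; congr (ep _ _ _).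
  have := dle_coord b uq; have := dle_coord b qv.
  by case: abs => -[h [-> ->]]; rewrite !ler_norml; lra.
have Lxy : `|x b - p b| + `|p b - y b| <= `|x b - y b| by lra.
have [h|h] : ((y b <= p b <= z b) || (z b <= p b <= y b)) \/
    ((z b <= p b <= x b) || (x b <= p b <= z b)).
- have {}Lxy : (x b <= p b <= y b) \/ (y b <= p b <= x b).
    have [xy|yx] := leP (x b) (y b).
      left; move: Lxy; rewrite (@ler0_norm _ (x b - y b)); last lra.
      have := ler_norm (p b - x b); have := ler_norm (x b - p b).
      have := ler_norm (p b - y b); have := ler_norm (y b - p b).
      rewrite (distrC (y b)) (distrC (p b) (x b)); lra.
    right; move: Lxy; rewrite (@ger0_norm _ (x b - y b)); last lra.
    have := ler_norm (p b - x b); have := ler_norm (x b - p b).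
    have := ler_norm (p b - y b); have := ler_norm (y b - p b).
    rewrite (distrC (y b)) (distrC (p b) (x b)); lra.
  by lra.
- apply: dist_to_set_le (dlexx p); left; exact: on gB py' pz h.
- apply: dist_to_set_le (dlexx p); right; exact: on gC pz px h.
Qed.

Section Potential.
Variable c : nat -> V.
Hypothesis c_adj : forall i, adj (c i) (c i.+1).

(* [phi / 2] is 1-Lipschitz on the vertices; the factor 2 allows midpoints of
   edges as base points. *)
Lemma dist_walk_point_ge (phi : V -> int) s t l0 : 0 <= s -> 0 <= t ->
  (forall u v, adj u v -> phi v <= phi u + 2) ->
  (phi (c (Num.truncn s)))%:~R / 2 <= s - (Num.truncn s)%:R ->
  (phi (c (Num.truncn s).+1))%:~R / 2 <= (Num.truncn s)%:R + 1 - s ->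
  (forall j : nat, `|t - j%:R| <= 1 ->
     l0 <= (phi (c j))%:~R / 2 + `|t - j%:R|) ->
  (exists2 j : nat, `|t - j%:R| < 1 &
     c j <> c (Num.truncn s) /\ c j <> c (Num.truncn s).+1) ->
  (l0%:E <= dist (walk_point c s) (walk_point c t))%E.
Proof.
move=> s0 t0 lip; set i := Num.truncn s => hi hi1 hl [j0 tj0 [j0i j0i1]].
have si := truncn_bounds s0; rewrite -/i in si.
(* Along a walk of [k] steps [phi / 2] grows by at most [k], so [k] is at least this growth. *)
have key k (e : R) v a : walk adj k v a -> 0 < walk_point c t a ->
    (phi v)%:~R / 2 <= e -> l0 <= e + k%:R + (1 - walk_point c t a).
  move=> wk ta ve; have [j [aj _ tj]] := walk_point_supp c_adj t0 ta.
  have tj1 : `|t - j%:R| <= 1 by rewrite -tj; lra.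
  have := hl _ tj1; rewrite -tj -aj.
  have : ((phi a)%:~R : R) <= (phi v)%:~R + 2 * k%:R.
    rewrite -[k%:R]/((k%:Z)%:~R) -[2 : R]/(2%:~R) -intrM -intrD ler_int.
    exact: walk_le lip wk.
  lra.
apply: dist_edge_ge => //; first by lra.
- by move=> k a wk ta; apply: (key _ _ _ _ wk ta).
- by move=> k a wk ta; apply: (key _ _ _ _ wk ta); lra.
- exists (c j0) => //; rewrite (walk_point_val c_adj t0 tj0); lra.
Qed.

End Potential.

Lemma subsingleton_hyperbolicity : (forall u v : V, u = v) ->
  (hyperbolicity (R := R) adj <= 0%:E)%E.
Proof.
move=> V1; rewrite -[0 in leRHS](mul0r 2^-1).
apply: hyperbolicity_le_half_diam => // x y.
have ptE z : points z -> exists v, z = vtx v.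
  by case=> [//|[u [v [t [/adjN uv]]]]]; case: (uv (V1 u v)).
by move=> /ptE[u ->] /ptE[v ->]; rewrite (V1 u v); apply: dlexx.
Qed.

End MetricGraphTheory.

(** * Arcs and their lifts to the real line *)

Section Circle.
Context {R : realType}.
Local Notation pi2 := (pi *+ 2 : R).

Lemma pi2_gt0 : 0 < pi2. Proof. by rewrite mulrn_wgt0 ?pi_gt0. Qed.

Lemma angle_pointD2pi (x : R) (k : int) :
  angle_point (x + pi2 * k%:~R) = angle_point x.
Proof.
have hn (n : nat) y : angle_point (y + pi2 * n%:R) = angle_point y :> R * R.
  elim: n => [|n IH]; first by rewrite mulr0 addr0.
  rewrite -natr1 mulrDr mulr1 addrA -[RHS]IH.
  by rewrite /angle_point cosD2pi sinD2pi.
case: k => n; first exact: hn.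
by rewrite NegzE mulrNz mulrN -[x in RHS](subrK (pi2 * n.+1%:R)) hn.
Qed.

(** Reduction modulo [2 pi] to [[0, 2 pi)]; the upper half of this interval is reflected, to use the
    injectivity of [cos] on [[0, pi]]. *)
Lemma cos_eq1 (x : R) : cos x = 1 -> exists k : int, x = pi2 * k%:~R.
Proof.
move=> cx; have p0 := pi2_gt0.
pose k := Num.floor (x / pi2); exists k.
have := Num.Theory.floor_itv (x / pi2); rewrite -/k intrD.
set y := x - pi2 * k%:~R => /andP[kx xk].
have y0 : 0 <= y by rewrite subr_ge0 mulrC -ler_pdivlMr.
have y1 : y < pi2.
  by rewrite ltrBlDr -[X in X + _]mulr1 -mulrDr mulrC -ltr_pdivrMr// addrC.
have cy : cos y = 1.
  have := angle_pointD2pi y k; rewrite subrK => /(congr1 fst) /=.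
  by rewrite cx.
suff : y = 0 by rewrite /y => /eqP; rewrite subr_eq0 => /eqP.
have inj z : 0 <= z <= pi -> cos z = 1 -> z = 0.
  move=> z0 cz; apply: cos_inj; rewrite ?in_itv /= ?z0 ?lexx ?pi_ge0//.
  by rewrite cz cos0.
have [ypi|ypi] := leP y pi; first by apply: inj => //; rewrite y0.
have : pi2 - y = 0.
  apply: inj; last by rewrite -cosN opprB -(cosD2pi (y - pi2)) subrK.
  by rewrite mulr2n in y1 *; lra.
by rewrite mulr2n in y1 *; lra.
Qed.

Lemma angle_pointP (x y : R) :
  angle_point x = angle_point y <-> exists k : int, x = y + pi2 * k%:~R.
Proof.
split=> [[cxy sxy]|[k ->]]; last exact: angle_pointD2pi.
have : cos (x - y) = 1 by rewrite cosB cxy sxy -!expr2 cos2Dsin2.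
by move=> /cos_eq1[k xy]; exists k; rewrite -xy addrC subrK.
Qed.

Lemma circle_angle (x : R) : circle (angle_point x).
Proof. exact: cos2Dsin2. Qed.

Lemma angle_surj (z : R * R) : circle z -> exists x, z = angle_point x.
Proof.
case: z => a b; rewrite /circle /= => ab.
have a1 : -1 <= a <= 1 by nra.
have ca : cos (acos a) = a by apply: acosK; rewrite in_itv.
have sb : sin (acos a) = `|b|.
  by rewrite sin_acos// -ab addrC addKr sqrtr_sqr.
have [b0|b0] := leP 0 b.
  by exists (acos a); rewrite /angle_point ca sb ger0_norm.
by exists (- acos a); rewrite /angle_point cosN ca sinN sb ltr0_norm// opprK.
Qed.

End Circle.

Section Lifts.
Context {R : realType} {V : Type} (arc : V -> set (R * R)) (cl : bool).
Variables lo0 hi0 : V -> R.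
Local Notation pi2 := (pi *+ 2 : R).

(** Indexed form of a total set; since [f] may repeat, [n] is only an upper bound for the number of
    arcs. *)
Definition total_upto n (f : nat -> V) :=
  forall x : R, exists2 i, (i < n)%N & arc (f i) (angle_point x).

(** Lifts are pairs of a vertex and a number of full turns; the flag [cl] of [lifted_arc] treats
    closed and open arcs at once. *)
Definition lower_end (w : V * int) : R := lo0 w.1 + pi2 * w.2%:~R.
Definition upper_end (w : V * int) : R := hi0 w.1 + pi2 * w.2%:~R.

Definition lifted_arc (w : V * int) : set R :=
  [set x | (lower_end w < x ?<= if cl) && (x < upper_end w ?<= if cl)].

Hypothesis lo_hi : forall v, lo0 v < hi0 v.
Hypothesis arcE : forall v, arc v = angle_point @`
  [set x | (lo0 v < x ?<= if cl) && (x < hi0 v ?<= if cl)].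

Definition meet (u v : V) := arc u `&` arc v !=set0.
Definition lifts_meet (w w' : V * int) := lifted_arc w `&` lifted_arc w' !=set0.

Lemma lifted_arc_mid w : lifted_arc w ((lower_end w + upper_end w) / 2).
Proof.
have := lo_hi w.1.
by rewrite /lifted_arc /= /lower_end /upper_end; case: (cl) => /=; lra.
Qed.

Lemma lifted_arc_itv w x y z : lifted_arc w x -> lifted_arc w z ->
  x <= y <= z -> lifted_arc w y.
Proof. by rewrite /lifted_arc /=; case: (cl) => /=; lra. Qed.

Lemma lifted_arc_shift v k m x :
  lifted_arc (v, k) x -> lifted_arc (v, k + m) (x + pi2 * m%:~R).
Proof.
rewrite /lifted_arc /= /lower_end /upper_end /= intrD mulrDr.
by case: (cl) => /=; lra.
Qed.

Lemma arc_lifted v x :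
  arc v (angle_point x) <-> exists k, lifted_arc (v, k) x.
Proof.
rewrite arcE; split.
  case=> y Jy /angle_pointP[k yx]; exists (- k); move: Jy; rewrite {}yx.
  rewrite /lifted_arc /= /lower_end /upper_end /= mulrNz.
  by case: (cl) => /=; lra.
case=> k; rewrite /lifted_arc /= /lower_end /upper_end /= => Lx.
exists (x - pi2 * k%:~R).
  by move: Lx; rewrite /=; case: (cl) => /=; lra.
by apply/angle_pointP; exists (- k); rewrite mulrNz; ring.
Qed.

Lemma arc_angle v z : arc v z -> exists x, z = angle_point x.
Proof. by rewrite arcE => -[x _ <-]; exists x. Qed.

Lemma meet_lift u v k : meet u v -> exists j, lifts_meet (u, k) (v, j).
Proof.
case=> z [uz vz]; have [x zx] := arc_angle uz; subst z.
case/arc_lifted: uz => i ux; case/arc_lifted: vz => j vx.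
exists (j + (k - i)), (x + pi2 * (k - i)%:~R); split; last exact: lifted_arc_shift.
have -> : (u, k) = (u, i + (k - i)) by congr pair; lia.
exact: lifted_arc_shift.
Qed.

Lemma lifts_meetW w w' : lifts_meet w w' -> meet w.1 w'.1.
Proof.
case: w w' => [u k] [v j] [x [ux vx]]; exists (angle_point x).
by split; apply/arc_lifted; [exists k|exists j].
Qed.

Lemma lifts_meetC w w' : lifts_meet w w' -> lifts_meet w' w.
Proof. by case=> x [? ?]; exists x. Qed.

Lemma meetC u v : meet u v -> meet v u.
Proof. by case=> x [? ?]; exists x. Qed.

Lemma meetxx u : meet u u.
Proof.
apply: (@lifts_meetW (u, 0) (u, 0)).
by exists ((lower_end (u, 0) + upper_end (u, 0)) / 2); split; apply: lifted_arc_mid.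
Qed.

Lemma lifts_meet_shift u k v j m :
  lifts_meet (u, k) (v, j) -> lifts_meet (u, k + m) (v, j + m).
Proof.
by case=> x [ux vx]; exists (x + pi2 * m%:~R); split; apply: lifted_arc_shift.
Qed.

Lemma walk_lift_shift n u k v j m : walk lifts_meet n (u, k) (v, j) ->
  walk lifts_meet n (u, k + m) (v, j + m).
Proof.
elim: n u k => [|n IH] u k /=; first by case=> -> ->.
by case=> -[w i] /(lifts_meet_shift m) h /IH h'; exists (w, i + m).
Qed.

(** Path lifting: the start of the lift is prescribed, and its end [j] records the winding. *)
Lemma walk_lift n u v k : walk meet n u v ->
  exists j, walk lifts_meet n (u, k) (v, j).
Proof.
elim: n u k => [|n IH] u k /=; first by move=> ->; exists k.
by case=> w /(meet_lift k)[i uw] /(IH w i)[j wv]; exists j, (w, i).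
Qed.

(* Consecutive lifts meet, so together they cover everything between the two
   ends; two distinct lifts of one arc are at least a full turn apart. *)
Lemma closed_lift_total n (c : nat -> V * int) v k k' :
  c 0%N = (v, k) -> c n = (v, k') ->
  (forall i, (i < n)%N -> lifts_meet (c i) (c i.+1)) -> k <> k' ->
  total_upto n (fun i => (c i).1).
Proof.
move=> c0 cn cm kk' t.
have n0 : (0 < n)%N by case: n {cm} cn => // cn; case: kk'; move: cn; rewrite c0 => -[].
(* Intermediate values: consecutive lifts overlap, so those up to [i] cover everything between a
   point of the first and a point of the last. *)
have cover i x y z : (i <= n)%N -> lifted_arc (c 0%N) x -> lifted_arc (c i) y ->
    x <= z <= y \/ y <= z <= x -> exists2 j, (j <= i)%N & lifted_arc (c j) z.
  elim: i y => [|i IH] y ni cx cy h.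
    by exists 0%N => //; case: h => h; [apply: lifted_arc_itv cx cy h|
                                      apply: lifted_arc_itv cy cx h].
  have [m [im im1]] := cm _ ni.
  have [h1|h1] : ((x <= z <= m \/ m <= z <= x) \/ (m <= z <= y \/ y <= z <= m)) by lra.
    have [j ji zj] := IH m (ltnW ni) cx im h1.
    by exists j => //; apply: leqW.
  by exists i.+1 => //; case: h1 => h1; [apply: lifted_arc_itv im1 cy h1|
                                      apply: lifted_arc_itv cy im1 h1].
have p0 := @pi2_gt0 R.
set x := (lower_end (c 0%N) + upper_end (c 0%N)) / 2.
have Lx : lifted_arc (c 0%N) x by apply: lifted_arc_mid.
have Ly : lifted_arc (c n) (x + pi2 * (k' - k)%:~R).
  have -> : c n = (v, k + (k' - k)) by rewrite cn; congr pair; lia.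
  by apply: lifted_arc_shift; rewrite -c0.
(* [xx] is the left end of a full turn contained between the two lifts, and [z] is the translate of
   [t] in it. *)
pose xx := if k < k' then x else x + pi2 * (k' - k)%:~R.
pose m := Num.ceil ((xx - t) / pi2).
pose z := t + pi2 * m%:~R.
have zb : xx <= z <= xx + pi2.
  have := Num.Theory.ceil_itv ((xx - t) / pi2); rewrite -/m intrD => /andP[h1 h2].
  apply/andP; split.
    by rewrite /z -lerBlDl mulrC -ler_pdivrMr.
  rewrite ltr_pdivlMr// in h1; rewrite /z; move: h1; rewrite mulrC mulrDr.
  by rewrite [pi2 * (-1)%:~R]mulrN1; lra.
have zxy : x <= z <= x + pi2 * (k' - k)%:~R \/ x + pi2 * (k' - k)%:~R <= z <= x.
  move: zb; rewrite /xx; case: ifPn => kk zb; [left|right].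
    have : 1 <= (k' - k)%:~R :> R by rewrite -[1]/(1%:~R) ler_int; lia.
    by nra.
  have : (k' - k)%:~R <= - 1 :> R by rewrite -[- 1]/((-1)%:~R) ler_int; lia.
  by nra.
have [j jn zj] := cover n x _ z (leqnn n) Lx Ly zxy.
have {zj} : arc (c j).1 (angle_point t).
  rewrite -(angle_pointD2pi t m) -/z; apply/arc_lifted; exists (c j).2.
  by rewrite -surjective_pairing.
(* The last lift belongs to the same arc as the first, so the index [n] can be replaced by [0]. *)
have [jn'|jn'] := ltnP j n; first by exists j.
have -> : j = n by lia.
by rewrite cn => h; exists 0%N => //; rewrite c0.
Qed.

Lemma winding_total n v k k' :
  walk lifts_meet n (v, k) (v, k') -> k <> k' -> exists f, total_upto n f.
Proof.
move=> wk kk'; have [c [c0 cn cm]] := walkP wk; exists (fun i => (c i).1).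
exact: closed_lift_total c0 cn cm kk'.
Qed.

(* A point just beyond the upper end of [w] lies in one of finitely many arcs;
   this is where mixing open and closed arcs would fail. *)
Lemma greedy_step n f w : total_upto n f -> exists i k,
  [/\ (i < n)%N, lifts_meet w (f i, k) & upper_end w < upper_end (f i, k)].
Proof.
move=> tot; set T := upper_end w.
have lowT : lower_end w < T by rewrite ltrD2r.
have p0 := @pi2_gt0 R.
have [clT|clF] := boolP cl; last first.
  (* With open arcs, the arc containing the upper end [T] itself extends beyond it. *)
  have [i ni /arc_lifted[k Lk]] := tot T; exists i, k.
  move: Lk; rewrite /lifted_arc /= (negbTE clF) /= => /andP[h1 h2]; split=> //.
  pose x := Num.max (lower_end w) (lower_end (f i, k)).
  have x1 : lower_end w <= x by rewrite le_max lexx.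
  have x2 : lower_end (f i, k) <= x by rewrite le_max lexx orbT.
  have x3 : x < T by rewrite gt_max lowT.
  by exists ((x + T) / 2); rewrite /lifted_arc /= (negbTE clF) /= -/T; split; lra.
(* With closed arcs, failure would mean that the lifts containing points beyond [T] all start beyond
   [T]; but the lower ends beyond [T] of finitely many arcs stay at a positive distance [e] from
   it. *)
apply: contrapT => none.
have far y : T < y -> exists i k,
    [/\ (i < n)%N, T < lower_end (f i, k) & lower_end (f i, k) <= y].
  move=> Ty; have [i ni /arc_lifted[k]] := tot y.
  rewrite /lifted_arc /= clT /= => /andP[h1 h2]; exists i, k; split=> //.
  rewrite ltNge; apply/negP => h; apply: none; exists i, k; split=> //; last by lra.
  by exists T; rewrite /lifted_arc /= clT /= -/T; split; lra.
have gap v : exists2 e : R, 0 < e &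
    forall k, T < lower_end (v, k) -> T + e <= lower_end (v, k).
  pose m := Num.floor ((T - lo0 v) / pi2).
  have := Num.Theory.floor_itv ((T - lo0 v) / pi2); rewrite -/m => /andP[h1 h2].
  have {}h1 : lower_end (v, m) <= T.
    by rewrite /lower_end /= -lerBrDl mulrC -ler_pdivlMr.
  have {}h2 : T < lower_end (v, m + 1).
    by rewrite /lower_end /= -ltrBlDl mulrC -ltr_pdivrMr.
  exists (lower_end (v, m + 1) - T); first lra.
  move=> k Tk; rewrite addrC subrK /lower_end /= lerD2l ler_pM2l// ler_int.
  have : lower_end (v, m) < lower_end (v, k) by lra.
  by rewrite /lower_end /= ltrD2l ltr_pM2l// ltr_int; lia.
have [e e0 he] : exists2 e : R, 0 < e &
    forall i k, (i < n)%N -> T < lower_end (f i, k) -> T + e <= lower_end (f i, k).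
  elim: (n) => [|m [e e0 he]]; first by exists 1.
  have [e' e'0 he'] := gap (f m); exists (Num.min e e'); first by rewrite lt_min e0.
  have me : Num.min e e' <= e by rewrite ge_min lexx.
  have me' : Num.min e e' <= e' by rewrite ge_min lexx orbT.
  move=> i k; rewrite ltnS leq_eqVlt => /orP[/eqP ->|im] Tk.
    by have := he' _ Tk; lra.
  by have := he _ _ im Tk; lra.
have Te : T < T + e / 2 by lra.
have [i [k [ni Tk kT]]] := far _ Te.
by have := he _ _ ni Tk; lra.
Qed.

Variable n : nat.
Hypothesis total_min : forall m g, total_upto m g -> (n <= m)%N.

(** Among the first [n + 1] greedy lifts two lie over the same index; the arcs between them are
    total, so by minimality this closed walk consists of exactly the first [n] steps. It is then
    repeated with a shift of [W] turns. *)
Lemma greedy_cycle f : (0 < n)%N -> total_upto n f ->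
  exists (c : nat -> V * int) (W : int),
    [/\ W <> 0, forall i, lifts_meet (c i) (c i.+1),
        forall i, c (i + n)%N = ((c i).1, (c i).2 + W) &
        total_upto n (fun i => (c i).1)].
Proof.
move=> n0 tot.
have [nx nxP] : {nx : V * int -> nat * int & forall w, [/\ ((nx w).1 < n)%N,
    lifts_meet w (f (nx w).1, (nx w).2) &
    upper_end w < upper_end (f (nx w).1, (nx w).2)]}.
  apply: (@choice _ _ (fun w ik => [/\ (ik.1 < n)%N,
    lifts_meet w (f ik.1, ik.2) & upper_end w < upper_end (f ik.1, ik.2)])) => w.
  by have [i [k ?]] := greedy_step w tot; exists (i, k).
pose s := fix s j := if j is j'.+1 then nx (f (s j').1, (s j').2) else (0%N, 0).
pose w j := (f (s j).1, (s j).2).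
have sn j : ((s j).1 < n)%N by case: j => //= j; case: (nxP (w j)).
have ww j : lifts_meet (w j) (w j.+1) by case: (nxP (w j)).
have up j : upper_end (w j) < upper_end (w j.+1) by case: (nxP (w j)).
have upS i j : (i < j)%N -> upper_end (w i) < upper_end (w j).
  elim: j => // j IH; rewrite ltnS leq_eqVlt => /orP[/eqP ->//|/IH h].
  exact: lt_trans h (up j).
have p0 := @pi2_gt0 R.
have [i [j [ij jn sij]]] : exists i j, [/\ (i < j)%N, (j <= n)%N & (s i).1 = (s j).1].
  apply: contrapT => none.
  have : injective (fun j : 'I_n.+1 => Ordinal (sn j)).
    move=> i j [sij]; apply: val_inj => /=.
    case: (ltngtP i j) => // ij; exfalso; apply: none; [exists i, j|exists j, i];
      by split=> //; rewrite -ltnS ltn_ord.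
  by move=> /leq_card; rewrite !card_ord ltnn.
(* Upper ends increase strictly, so the two lifts of the repeated arc are distinct. *)
have kij : (s i).2 <> (s j).2.
  by move=> h; have := upS _ _ ij; rewrite /w sij h ltxx.
have tot' : total_upto (j - i) (fun l => (w (i + l)%N).1).
  apply: (@closed_lift_total _ (fun l => w (i + l)%N) (w i).1 (w i).2 (w j).2) => //.
  - by rewrite addn0 /w.
  - by rewrite subnKC ?(ltnW ij)// /w sij.
  - by move=> l _; rewrite addnS.
have := total_min tot' => nij.
have ? : i = 0%N by lia. have ? : j = n by lia. subst i j.
rewrite subn0 in tot'; pose W := (s n).2 - (s 0%N).2.
exists (fun l => ((w (l %% n)%N).1, (w (l %% n)%N).2 + W * (l %/ n)%N%:Z)), W.
split.
- by rewrite /W; lia.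
- move=> l; have ln := ltn_pmod l n0; have dl := divn_eq l n.
  set r := (l %% n)%N in ln dl *; set d := (l %/ n)%N in dl *.
  have [rn|rn] := ltnP r.+1 n.
    have -> : (l.+1 %% n)%N = r.+1 by rewrite dl -addnS modnMDl modn_small.
    have -> : (l.+1 %/ n)%N = d by rewrite dl -addnS divnMDl// divn_small// addn0.
    by apply: lifts_meet_shift; rewrite -!surjective_pairing.
  have rn1 : n = r.+1 by lia.
  have ln1 : l.+1 = (d.+1 * n)%N by rewrite dl rn1 mulSn; lia.
  rewrite ln1 modnMl mulnK//.
  have -> : ((w 0%N).1, (w 0%N).2 + W * d.+1%:Z) = ((w n).1, (w n).2 + W * d%:Z).
    by rewrite /w -sij; congr pair; rewrite /W /=; lia.
  by apply: lifts_meet_shift; rewrite -!surjective_pairing rn1.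
- by move=> l; rewrite modnDr divnDr// divnn n0 /= addn1; congr pair; lia.
- move=> t; have [l ln h] := tot' t; exists l => //=.
  by rewrite modn_small.
Qed.

(** * Distances along the cycle of a minimum total set *)

Definition arcs_adj (u v : V) := u <> v /\ meet u v.

Lemma arcs_adjC u v : arcs_adj u v -> arcs_adj v u.
Proof. by case=> uv /meetC h; split=> // /esym. Qed.

Lemma arcs_adjN u v : arcs_adj u v -> u <> v. Proof. by case. Qed.

(** [meet] is reflexive, unlike adjacency; the stationary steps are dropped. *)
Lemma walk_meet_adj k u v : walk meet k u v ->
  exists2 k', (k' <= k)%N & walk arcs_adj k' u v.
Proof.
elim: k u => [|k IH] u /=; first by move=> ->; exists 0%N.
case=> w uw /IH[k' kk' wv]; have [->|uNw] := pselect (u = w).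
  by exists k'; rewrite ?leqW.
by exists k'.+1 => //; exists w.
Qed.

Lemma walk_adj_meet k u v : walk arcs_adj k u v -> walk meet k u v.
Proof. by apply: walk_homo => x y []. Qed.

Section Cycle.
Hypothesis n_gt0 : (0 < n)%N.
Variables (c : nat -> V * int) (W : int).
Hypothesis c_meet : forall i, lifts_meet (c i) (c i.+1).
Hypothesis c_periodic : forall i, c (i + n)%N = ((c i).1, (c i).2 + W).
Hypothesis c_total : total_upto n (fun i => (c i).1).

Lemma walk_cycle i j : (i <= j)%N -> walk meet (j - i) (c i).1 (c j).1.
Proof.
move=> ij; rewrite -{2}(subnKC ij).
apply: (@walk_seq _ _ (fun l => (c l).1)) => l _.
exact: lifts_meetW (c_meet l).
Qed.

Lemma vertices_diam u v :
  exists2 k, (k <= n./2 + 2)%N & walk arcs_adj k u v.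
Proof.
have near x : exists2 i, (i < n)%N & meet x (c i).1.
  have [z [xz _]] := meetxx x; have [t zt] := arc_angle xz; subst z.
  by have [i ni ci] := c_total t; exists i => //; exists (angle_point t).
have [i ni ui] := near u; have [j nj vj] := near v.
suff [k kn wk] : exists2 k : nat, (k <= n./2)%N & walk meet k (c i).1 (c j).1.
  have : walk meet (1 + (k + 1)) u v.
    apply: (walk_cat (b := (c i).1)); first by exists (c i).1.
    by apply: walk_cat wk _; exists v => //; apply: meetC.
  by move=> /walk_meet_adj[k' kk' w]; exists k' => //; lia.
wlog ij : i j u v ni nj {ui vj} / (i <= j)%N.
  move=> h; have [ij|/ltnW ij] := leqP i j; first exact: h.
  have [k kn wk] := h j i u v nj ni ij; exists k => //.
  by apply: walk_sym wk => x y; apply: meetC.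
have [near_ij|far] := leqP (j - i) n./2.
  by exists (j - i)%N => //; apply: walk_cycle.
(* More than [n./2] steps one way leave at most [n./2] the other way round. *)
exists (i + n - j)%N; first lia.
have -> : (c i).1 = (c (i + n)%N).1 by rewrite c_periodic.
apply: walk_sym; first by move=> x y; apply: meetC.
by apply: walk_cycle; lia.
Qed.

Hypothesis W_neq0 : W <> 0.

(* A walk of length [K] closes up with either of the two ways around the cycle;
   were both closed walks shorter than [n], both would have winding number zero,
   whereas their winding numbers differ by [W]. *)
Lemma walk_cycle_ge K i j : (i <= j <= i + n)%N ->
  walk arcs_adj K (c i).1 (c j).1 -> (j - i <= K)%N \/ (i + n - j <= K)%N.
Proof.
move=> /andP[ij jin] /walk_adj_meet /(walk_lift (c i).2)[m wm].
have [?|K1] := leqP (j - i) K; [by left|].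
have [?|K2] := leqP (i + n - j) K; [by right|exfalso].
have lift_eq l v k k' : (l < n)%N -> walk lifts_meet l (v, k) (v, k') -> k = k'.
  move=> mn w; apply: contrapT => /(winding_total w)[f /total_min]; lia.
have wl a b : (a <= b)%N -> walk lifts_meet (b - a) (c a) (c b).
  by move=> ab; rewrite -{2}(subnKC ab); apply: walk_seq.
have mj : m = (c j).2.
  have back : walk lifts_meet (j - i) ((c j).1, (c j).2) ((c i).1, (c i).2).
    rewrite -!surjective_pairing; apply: walk_sym (wl _ _ ij) => x y.
    exact: lifts_meetC.
  have := walk_lift_shift (m - (c j).2) back.
  have -> : (c j).2 + (m - (c j).2) = m by lia.
  move=> b; have := lift_eq _ _ _ _ _ (walk_cat wm b); lia.
have forth : walk lifts_meet (i + n - j) ((c j).1, (c j).2) ((c i).1, (c i).2 + W).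
  by rewrite -surjective_pairing -c_periodic; apply: wl.
rewrite mj in wm; have := lift_eq _ _ _ _ _ (walk_cat wm forth).
move: W_neq0; lia.
Qed.

Lemma cycle_neq i j : (i < j < i + n)%N -> (c i).1 <> (c j).1.
Proof.
move=> ij h; have : walk arcs_adj 0 (c i).1 (c j).1 by [].
by move=> /walk_cycle_ge[]; lia.
Qed.

Lemma cycle_adj i : (1 < n)%N -> arcs_adj (c i).1 (c i.+1).1.
Proof.
by move=> n1; split; [apply: cycle_neq; lia | apply: lifts_meetW].
Qed.

Local Notation cycle_point := (walk_point (R := R) (fun i => (c i).1)).

(** [walk_cycle_ge] bounds the walks from an end of the edge carrying [s] to an end of the edge
    carrying the antipode, and [dist_edge_ge] turns this into a bound between the points. *)
Lemma cycle_antipodal s l : (2 < n)%N -> 0 <= s ->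
  dle arcs_adj (cycle_point s) (cycle_point (s + n%:R / 2)) l -> n%:R / 2 <= l.
Proof.
move=> n2 s0; have n1 : (1 < n)%N by lia.
have cadj i : arcs_adj (c i).1 (c i.+1).1 by apply: cycle_adj.
have nR : 3 <= n%:R :> R by rewrite (ler_nat R 3).
have sn0 : 0 <= s + n%:R / 2 by lra.
have := truncn_bounds s0; set i := Num.truncn s => si.
have := truncn_bounds sn0; set i' := Num.truncn (s + n%:R / 2) => si'.
have ii' : (i.+1 <= i')%N.
  suff : (i.+1%:R : R) < i'.+1%:R by rewrite ltr_nat.
  by rewrite -!natr1; lra.
have i'n : (i'.+1 <= i + n)%N.
  suff : ((i'.+1 * 2)%:R : R) < (i * 2 + n + 4)%:R by rewrite ltr_nat; lia.
  by rewrite !(natrM, natrD, =^~ natr1); lra.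
have half : ((uphalf n * 2)%:R : R) = n%:R \/ ((uphalf n * 2)%:R : R) = n%:R + 1.
  have [] : (uphalf n * 2 = n \/ uphalf n * 2 = n.+1)%N by lia.
    by move=> ->; left.
  by move=> ->; right; rewrite natr1.
have key k i0 a (e : R) : (i <= i0 <= i.+1)%N -> - e <= s - i0%:R <= e ->
    walk arcs_adj k (c i0).1 a -> 0 < cycle_point (s + n%:R / 2) a ->
    n%:R / 2 <= e + k%:R + (1 - cycle_point (s + n%:R / 2) a).
  move=> ii0 se wk qa; have [j [aj ij ->]] := walk_point_supp arcs_adjN cadj sn0 qa.
  rewrite -/i' in ij; rewrite {}aj in wk qa.
  have bj : (j%:R : R) - (s + n%:R / 2) <= `|s + n%:R / 2 - j%:R|.
    by rewrite distrC ler_norm.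
  have bj' := ler_norm (s + n%:R / 2 - j%:R).
  have i0j : (i0 <= j <= i0 + n)%N by clear - ii0 ij ii' i'n; lia.
  have [h|h] := walk_cycle_ge i0j wk.
    have : (j%:R : R) <= (k + i0)%:R by rewrite ler_nat; clear - h; lia.
    by rewrite natrD; lra.
  have : ((i0 + n)%:R : R) <= (k + j)%:R by rewrite ler_nat; clear - h; lia.
  by rewrite !natrD; lra.
apply: dle_dist_ge; rewrite [X in graph_dist _ X _]/walk_point -/i.
apply: dist_edge_ge => //; first exact: arcs_adjC.
- exact: arcs_adjN.
- by lra.
- by move=> k a wk qa; apply: (key _ _ _ _ _ _ wk qa); [lia|lra].
- by move=> k a wk qa; apply: (key _ _ _ _ _ _ wk qa); [lia|rewrite -natr1; lra].
(* This vertex is less than [1] away from the antipode, and [n > 2] keeps it off the edge carrying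
   [s]. *)
- exists (c (i + uphalf n)%N).1; last first.
    by split=> /esym; apply: cycle_neq; clear - n2; lia.
  have near : `|s + n%:R / 2 - (i + uphalf n)%:R| < 1.
    rewrite ltr_norml natrD; move: half; rewrite natrM; lra.
  by rewrite (walk_point_val arcs_adjN cadj sn0 near); lra.
Qed.

Lemma cycle_hyperbolicity_ge : (2 < n)%N ->
  ((n%:R / 4)%:E <= hyperbolicity (R := R) arcs_adj)%E.
Proof.
move=> n2.
have cadj i : arcs_adj (c i).1 (c i.+1).1 by apply: cycle_adj; lia.
apply: (@antipodal_hyperbolicity_ge R V arcs_adj (fun i => (c i).1) cadj).
- by move=> i; rewrite c_periodic.
- by move=> s l; apply: cycle_antipodal.
Qed.

End Cycle.

Lemma total_diam f : (0 < n)%N -> total_upto n f ->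
  forall u v, exists2 k, (k <= n./2 + 2)%N & walk arcs_adj k u v.
Proof.
move=> n0 tot; have [c [W [_ ? ? ?]]] := greedy_cycle n0 tot.
exact: vertices_diam.
Qed.

Lemma total_hyperbolicity_le f : (0 < n)%N -> total_upto n f ->
  (hyperbolicity (R := R) arcs_adj <= ((n./2)%:R / 2 + 3 / 2)%:E)%E.
Proof.
move=> n0 tot.
have -> : (n./2)%:R / 2 + 3 / 2 = ((n./2 + 2)%:R + 1) / 2 :> R.
  by rewrite natrD; lra.
have D0 : 0 <= ((n./2 + 2)%:R + 1 : R) by rewrite addr_ge0.
apply: (hyperbolicity_le_half_diam D0); apply: points_diam.
- exact: arcs_adjC.
- exact: total_diam tot.
Qed.

Lemma total_hyperbolicity_ge f : (2 < n)%N -> total_upto n f ->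
  ((n%:R / 4)%:E <= hyperbolicity (R := R) arcs_adj)%E.
Proof.
move=> n2 tot; have n0 : (0 < n)%N by lia.
by have [c [W [? ? ? _]]] := greedy_cycle n0 tot; apply: cycle_hyperbolicity_ge.
Qed.

End Lifts.

(** * Graphs without a total set *)

Section IntervalGraph.
Context {R : realType} {V : Type} (arc : V -> set (R * R)) (cl : bool).
Variables lo0 hi0 : V -> R.
Hypothesis lo_hi : forall v, lo0 v < hi0 v.
Hypothesis arcE : forall v, arc v = angle_point @`
  [set x | (lo0 v < x ?<= if cl) && (x < hi0 v ?<= if cl)].
Hypothesis no_total : forall n f, ~ total_upto arc n f.

Local Notation pt := (V -> R).
Local Notation vtx := (@vertex_point R V).
Local Notation ep := (@edge_point R V).
Local Notation adj := (arcs_adj arc).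
Local Notation dist := (@graph_dist R V adj).
Local Notation step := (@edge_step R V adj).
Local Notation points := (@graph_points R V adj).
Local Notation chain := (@chain R V adj).
Local Notation dle := (@dle R V adj).
Local Notation meet := (meet arc).
Local Notation lifted := (lifted_arc cl lo0 hi0).
Local Notation lifts_meet := (lifts_meet cl lo0 hi0).
Implicit Types (x y z p : pt) (l r s t e : R) (u v w q : V).

Let adjC := @arcs_adjC R V arc.
Let adjN := @arcs_adjN R V arc.
Let meet_refl := meetxx lo_hi arcE.

(** Without total sets every closed walk has winding number zero. *)
Lemma lift_unique n v k k' :
  walk lifts_meet n (v, k) (v, k') -> k = k'.
Proof.
move=> w; apply: contrapT => /(winding_total lo_hi arcE w)[f].
exact: no_total.
Qed.

(** * The region outside the closed neighbourhood of a vertex *)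

Section ClosedNeighbourhood.
Variable w : V.

Definition avoid u v := [/\ meet u v, ~ meet w u & ~ meet w v].

Lemma avoidC u v : avoid u v -> avoid v u.
Proof. by case=> h ? ?; split=> //; apply: meetC. Qed.

(** Each lift of an arc missing [w] lies entirely on one side of the point [a] of the lift [(w, 0)],
    and lifts that meet lie on the same side. *)
Lemma avoid_side k u u' i a (x : R) : ~ meet w u -> lifted (w, 0) a ->
  lifted (u, i) x -> walk avoid k u u' -> exists j,
  walk lifts_meet k (u, i) (u', j) /\
  forall x' : R, lifted (u', j) x' -> (a < x) = (a < x').
Proof.
move=> wu wa.
have same v j (y y' : R) : ~ meet w v -> lifted (v, j) y -> lifted (v, j) y' ->
    (a < y) = (a < y').
  move=> wv vy vy'; apply/idP/idP => h; rewrite ltNge; apply/negP => h';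
    apply: wv; apply: (lifts_meetW arcE (w := (w, 0)) (w' := (v, j)));
    exists a; split=> //; [apply: lifted_arc_itv vy' vy _|apply: lifted_arc_itv vy vy' _]; lra.
elim: k u i x wu => [|k IH] u i x wu ux /=.
  by move=> <-; exists i; split=> // x'; apply: same.
case=> v [uv _ wv] vu'; have [j [y [uy vy]]] := meet_lift arcE i uv.
have [m [vm hm]] := IH v j y wv vy vu'.
exists m; split; first by exists (v, j) => //; exists y.
by move=> x' /hm <-; apply: same ux uy.
Qed.

(* In the line, [q] and [q'] both bridge the gap between [w] and the connected
   union of the arcs of a walk that avoids [w]. *)
Lemma interval_clique q q' u u' k : meet w q -> meet w q' -> meet q u ->
  meet u' q' -> ~ meet w u -> ~ meet w u' -> walk avoid k u u' -> meet q q'.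
Proof.
move=> wq wq' qu uq' wu wu' wk.
have [i [a [wa qa]]] := meet_lift arcE 0 wq.
have [j [b [qb ub]]] := meet_lift arcE i qu.
have [m [wm side]] := avoid_side wu wa ub wk.
have [i' [b' [ub' qb']]] := meet_lift arcE m uq'.
have [m' [a' [qa' wa']]] := meet_lift arcE i' (meetC wq').
(* The closed walk from [w] through [q], [u], [u'], [q'] back to [w] does not wind, so [a] and [a']
   lie in the same lift of [w]. *)
have m0 : 0 = m'.
  apply: (@lift_unique (1 + (1 + (k + (1 + 1)))) w).
  apply: (walk_cat (b := (q, i))); first by exists (q, i) => //; exists a.
  apply: (walk_cat (b := (u, j))); first by exists (u, j) => //; exists b.
  apply: (walk_cat wm).
  apply: (walk_cat (b := (q', i'))); first by exists (q', i') => //; exists b'.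
  by exists (w, m') => //; exists a'.
subst m'; have bb := side _ ub'.
have out v n (y : R) : ~ meet w v -> lifted (v, n) y ->
    ~ (a <= y <= a' \/ a' <= y <= a).
  move=> wv vy h; apply: wv.
  apply: (lifts_meetW arcE (w := (w, 0)) (w' := (v, n))); exists y; split=> //.
  by case: h => h; [apply: lifted_arc_itv wa wa' h|apply: lifted_arc_itv wa' wa h].
have ob := out _ _ _ wu ub; have ob' := out _ _ _ wu' ub'.
apply: (lifts_meetW arcE (w := (q, i)) (w' := (q', i'))).
(* Of [a] and [a'], the one nearer to the walk lies in the lifts of both [q] and [q']. *)
have [ab|ba] := ltP a b.
  have ab' : a < b' by rewrite -bb.
  have [aa|aa] := leP a a'.
    by exists a'; split=> //; apply: lifted_arc_itv qa qb _; lra.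
  by exists a; split=> //; apply: lifted_arc_itv qa' qb' _; lra.
have ab' : b' <= a by move: bb; rewrite ltNge ba /= => /esym/negbT; rewrite -leNgt.
have [aa|aa] := leP a a'.
  by exists a; split=> //; apply: lifted_arc_itv qb' qa' _; lra.
by exists a'; split=> //; apply: lifted_arc_itv qb qa _; lra.
Qed.

(** The points touching the component of [u0] in the graph deprived of the closed neighbourhood of
    [w]. *)
Definition beyond u0 z := exists u k, [/\ z u <> 0, ~ meet w u & walk avoid k u0 u].

Definition gate u0 q := meet w q /\
  exists u k, [/\ ~ meet w u, walk avoid k u0 u & meet q u].

Lemma gate_neq u0 q : gate u0 q -> q <> w.
Proof. by case=> _ [u [k [wu _ qu]]] qw; apply: wu; rewrite -qw. Qed.

Lemma gate_clique u0 q q' : gate u0 q -> gate u0 q' -> meet q q'.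
Proof.
case=> wq [u [k [wu uk qu]]] [wq' [u' [k' [wu' uk' qu']]]].
have /interval_clique : walk avoid (k + k') u u'.
  exact: walk_cat (walk_sym avoidC uk) uk'.
by apply => //; apply: meetC.
Qed.

(** A step along an edge with an end [u] in the region can leave it only by hitting the other end,
    which is then a gate. *)
Lemma beyond_step u0 z z' l : beyond u0 z -> step z z' l ->
  beyond u0 z' \/ exists2 q, gate u0 q & z' = vtx q.
Proof.
case=> u [k [zu wu uk]] [a [b [s [t [ab s01 t01 [zs zt _]]]]]].
wlog ua : a b s t ab s01 t01 zs zt / u = a.
  move=> h; have : u = a \/ u = b.
    by apply: (@edge_point_supp R _ a b s); rewrite -zs.
  case=> ua; first exact: (h a b s t).
  apply: (h b a (1 - s) (1 - t)) => //; [exact: adjC|lra|lra| |];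
    by rewrite -edge_pointC.
subst a; have [t1|t1] := pselect (t = 1); last first.
  left; exists u, k; split=> //; rewrite zt edge_pointl; last exact: adjN.
  by lra.
have {}zt : z' = vtx b by rewrite zt t1 edge_point1.
have [wb|wb] := pselect (meet w b).
  right; exists b => //; split=> //; exists u, k; split=> //.
  by apply: meetC; case: ab.
left; exists b, k.+1; split=> //; first by rewrite zt vtx1; exact/eqP/oner_neq0.
by apply: walk_rcons uk _; split=> //; case: ab.
Qed.

Lemma beyond_chain u0 x p l : chain x p l -> beyond u0 x ->
  (forall u, p u <> 0 -> meet w u) -> exists q l1 l2,
  [/\ gate u0 q, chain x (vtx q) l1, chain (vtx q) p l2 & l1 + l2 = l].
Proof.
elim=> {x p l} [x|x y p l l' sxy cyp IH] bx hp.
  by case: bx => u [k [/hp]].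
have [by_|[q gq yq]] := beyond_step bx sxy.
  have [q [l1 [l2 [gq c1 c2 <-]]]] := IH by_ hp.
  exists q, (l + l1), l2; split=> //; last by rewrite addrA.
  exact: chainS sxy c1.
by exists q, l, l'; rewrite -yq; split=> //; apply: chain1.
Qed.

Variable p : pt.
Hypothesis pw : dle p (vtx w) (1/2).

(** Gates are within [1/2 + 1] of [p], so a point farther than [3/2] is not a gate; [e] is room for
    short chains. *)
Definition far e z := forall r, dle p z r -> 3/2 + e < r.

Lemma beyond_far_chain u0 z z' l e : chain z z' l -> l < e -> far e z ->
  beyond u0 z -> beyond u0 z'.
Proof.
move=> c; elim: c e => {z z' l} [//|x y z l l' sxy cyz IH e le fx bx].
have l0 := step_ge0 sxy; have l'0 := chain_ge0 cyz.
have fy : far (e - l) y.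
  move=> r /dle_trans/(_ (dle_sym (chain_dle (chain1 sxy))))/fx; lra.
apply: (IH (e - l)) => //; first lra.
have [//|[q gq yq]] := beyond_step bx sxy.
have wq : adj w q by split; [apply/nesym/gate_neq; exact: gq | case: gq].
by have := fy _; rewrite yq => /(_ _ (dle_trans pw (dle_adj adjC wq))); lra.
Qed.

Lemma beyond_geodesic u0 e A x y : 0 < e -> geodesic adj A x y ->
  (forall z, A z -> far e z) -> beyond u0 x -> beyond u0 y.
Proof.
move=> e0 [L [g [[L0 gx gy ->] [_ gd]]]] fA bx.
have fg s : 0 <= s <= L -> far e (g s).
  by move=> sL; apply: fA; exists s => //; rewrite /= in_itv.
suff main (k : nat) s : 0 <= s <= L -> s <= k%:R * (e / 2) -> beyond u0 (g s).
  rewrite -gy; apply: (main (Num.truncn (L / (e / 2))).+1); first by lra.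
  rewrite -ler_pdivrMr; last lra.
  by apply: ltW; apply: truncnS_gt.
elim: k s => [|k IH] s sL.
  by rewrite mul0r => s0; have -> : s = 0 by [lra]; rewrite gx.
rewrite -natr1 mulrDl mul1r => sk.
(* The geodesic is followed in pieces of length at most [e / 2], each replaced by a chain shorter
   than [e], which cannot reach a gate. *)
pose s' := Num.max 0 (s - e / 2).
have s'b : 0 <= s' /\ s - e / 2 <= s' by rewrite !le_max !lexx orbT.
have s'c : s' <= s by rewrite ge_max; lra.
have s'k : s' <= k%:R * (e / 2).
  by rewrite ge_max; apply/andP; split; [rewrite mulr_ge0//; lra|lra].
have s'L : 0 <= s' <= L by lra.
have /dleP : dle (g s') (g s) (s - s').
  by rewrite /dle gd// distrC ger0_norm//; lra.
have e4 : 0 < e / 4 by lra.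
move=> /(_ _ e4)[l c ll].
apply: (beyond_far_chain c _ (fg _ s'L) (IH _ s'L s'k)); lra.
Qed.

End ClosedNeighbourhood.

Lemma geodesic_sym A x y : geodesic adj A x y -> geodesic adj A y x.
Proof.
case=> L [g [[L0 gx gy ->] [gP gd]]]; exists L, (fun s => g (L - s)).
split; split=> //; rewrite ?subr0 ?subrr//.
- apply/seteqP; split=> z [s]; rewrite /= in_itv /= => sL <-.
    by exists (L - s); rewrite /= ?in_itv /=; [lra|congr g; ring].
  by exists (L - s); rewrite /= ?in_itv /=; [lra|].
- by move=> s sL; apply: gP; lra.
- move=> s t sL tL; rewrite gd; [|lra|lra].
  by rewrite distrC; congr (`| _ |%:E); ring.
Qed.

(** A vertex nearest to [x] has coordinate at least [1/2] in [x], hence meets [w]: the bound is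
    [1/2 + 1]. *)
Lemma near_closed_nbhd w x : points x ->
  (forall u, x u <> 0 -> meet w u) -> dle x (vtx w) (3/2).
Proof.
move=> px xw.
have main v t : (1/2 <= t)  -> x v = t -> dle x (vtx v) (1/2) ->
    dle x (vtx w) (3/2).
  move=> t2 xv dxv; have wv : meet w v by apply: xw; lra.
  have [vw|vw] := pselect (v = w); first by rewrite -vw; apply: dle_le dxv _; lra.
  have vw' : adj v w by split=> //; apply: meetC.
  by refine (dle_le (dle_trans dxv (dle_adj adjC vw')) _); lra.
have [v [xv|[v' [t [vv' t2 xv]]]]] := near_vertex adjC px.
  apply: (main v 1); rewrite ?xv ?vtx1//; first lra.
  by refine (dle_le (dlexx _ _) _); lra.
apply: (main v (1 - t)); rewrite ?xv ?edge_pointl//; try exact: adjN.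
  by lra.
by refine (dle_le (dle_edgel vv' _) _); lra.
Qed.

Lemma interval_thin A B C x y z p : geodesic adj A x y ->
  geodesic adj B y z -> geodesic adj C z x -> A p ->
  (dist_to_set adj p (B `|` C) <= (3/2)%:E)%E.
Proof.
move=> gA gB gC Ap.
have [L [L0 dxy Ax Ay PA]] := geodesicP gA.
have [_ [_ _ By Bz _]] := geodesicP gB.
have [_ [_ _ Cz Cx _]] := geodesicP gC.
have [pp [s [sL xp py]]] := PA _ Ap.
have [px _] := PA _ Ax; have [py_ _] := PA _ Ay.
apply/lee_addgt0Pr => e e0; rewrite leNgt; apply/negP => he.
have farBC b : (B `|` C) b -> far p e b.
  move=> bBC r pb; rewrite -lte_fin EFinD; apply: lt_le_trans he _.
  exact: dist_to_set_le bBC pb.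
have s32 : 3/2 + e < s by apply: (farBC x); [right|apply: dle_sym].
have Ls32 : 3/2 + e < L - s by apply: (farBC y); [left|].
have Lmin l : dle x y l -> L <= l by rewrite /dle dxy lee_fin.
(* [w] is a vertex nearest to [p]; the last clause bounds the weight of [p] off [w]. *)
have [w [pw supp small]] : exists w, [/\ dle p (vtx w) (1/2),
    forall u, p u <> 0 -> meet w u &
    forall q q', q <> w -> q' <> w -> p q <= 1/2 /\ (q <> q' -> p q + p q' <= 1/2)].
  have [w [->|[w' [t [ww' t2 ->]]]]] := near_vertex adjC pp; exists w; split.
  - by refine (dle_le (dlexx _ _) _); lra.
  - move=> u; have [->|uw] := pselect (u = w); first by move=> _; apply: meet_refl.
    by rewrite vtx0.
  - by move=> q q' qw q'w; rewrite !vtx0//; split; lra.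
  - by refine (dle_le (dle_edgel ww' _) _); lra.
  - move=> u wu; have [->|->] := edge_point_supp wu; [exact: meet_refl|by case: ww'].
  - move=> q q' qw q'w; have [qw'|qw'] := pselect (q = w').
      rewrite qw' edge_pointr; last exact: adjN.
      by split=> [|q'w']; [lra|rewrite edge_point_out//; [lra|apply/nesym]].
    rewrite edge_point_out//; split=> [|_]; first lra.
    have [->|q'w'] := pselect (q' = w'); last by rewrite edge_point_out//; lra.
    by rewrite edge_pointr; [lra|exact: adjN].
have farB b : B b -> far p e b by move=> ?; apply: farBC; left.
have farC b : C b -> far p e b by move=> ?; apply: farBC; right.
have start v a : a v <> 0 -> ~ meet w v -> beyond w v a.
  by move=> av wv; exists v, 0%N.
(* If neither end touched the outside, both would be within [3/2] of [w] and the side would have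
   length at most [3], while it exceeds [3 + 2 e]. *)
have [u0 [bx byy]] : exists u0, beyond w u0 x /\ beyond w u0 y.
  have [[v xv wv]|xin] := pselect (exists2 v, x v <> 0 & ~ meet w v).
    exists v; split; first exact: start.
    apply: (beyond_geodesic pw e0 (geodesic_sym gB)) => //.
    by apply: (beyond_geodesic pw e0 (geodesic_sym gC)) => //; apply: start.
  have [[v yv wv]|yin] := pselect (exists2 v, y v <> 0 & ~ meet w v).
    exists v; split; last exact: start.
    apply: (beyond_geodesic pw e0 gC) => //.
    by apply: (beyond_geodesic pw e0 gB) => //; apply: start.
  have near a : points a -> ~ (exists2 v, a v <> 0 & ~ meet w v) ->
      dle a (vtx w) (3/2).
    move=> pa ain; apply: near_closed_nbhd => // u au.
    by apply: contrapT => wu; apply: ain; exists u.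
  by have := Lmin _ (dle_trans (near _ px xin) (dle_sym (near _ py_ yin))); lra.
(* Avoiding [p] by the gates [q] and [q'] saves [2 - p q - p q'] and costs at most [1]: the gain is
   at least [1/2], more than the two errors of [1/8]. *)
have e8 : 0 < 1/8 :> R by lra.
have /dleP/(_ _ e8)[l cl' ll] := xp; have /dleP/(_ _ e8)[m cm ml] := dle_sym py.
have [q [l1 [l2 [gq c1 c2 ql]]]] := beyond_chain cl' bx supp.
have [q' [m1 [m2 [gq' c1' c2' qm]]]] := beyond_chain cm byy supp.
have qw := gate_neq gq; have q'w := gate_neq gq'.
have [pq pqq'] := small _ _ qw q'w; have [pq' _] := small _ _ q'w qw.
have coord v l0 : chain (vtx v) p l0 -> 1 - p v <= l0.
  move=> c; have := chain_coord adjN v c; rewrite vtx1; apply: le_trans.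
  exact: ler_norm.
have h2 := coord _ _ c2; have h2' := coord _ _ c2'.
have dx := chain_dle c1; have dy := dle_sym (chain_dle c1').
have [qq|qq] := pselect (q = q').
  by subst q'; have := Lmin _ (dle_trans dx dy); lra.
have aqq : adj q q' by split=> //; apply: gate_clique gq gq'.
have := Lmin _ (dle_trans dx (dle_trans (dle_adj adjC aqq) dy)).
by have := pqq' qq; lra.
Qed.

Lemma interval_hyperbolicity_le :
  (hyperbolicity (R := R) adj <= (3/2)%:E)%E.
Proof.
apply: hyperbolicity_le; first lra.
by move=> A B C x y z p gA gB gC; apply: interval_thin gA gB gC.
Qed.

End IntervalGraph.

(** * Bounds for circular-arc graphs *)

Section CircularArcGraphs.
Context {R : realType} (G : circular_arc_graph R).

Local Notation arc := (@Defs.arc R G).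

Lemma arc_ends : exists (cl : bool) (lo hi : vertex G -> R), (forall v, lo v < hi v) /\
  forall v, arc v = angle_point @`
    [set x | (lo v < x ?<= if cl) && (x < hi v ?<= if cl)].
Proof.
have [H|H] := @arcP R G.
  have [e eP] := choice (fun v : vertex G =>
    let: ex_intro a (ex_intro b h) := H v in ex_intro
      (fun e : R * R => e.1 < e.2 /\ arc v = angle_point @` `[e.1, e.2]) (a, b) h).
  exists true, (fun v => (e v).1), (fun v => (e v).2); split=> v.
    by have [] := eP v.
  by have [_ ->] := eP v; congr image; apply/seteqP; split=> x;
    rewrite /= in_itv.
have [e eP] := choice (fun v : vertex G =>
  let: ex_intro a (ex_intro b h) := H v in ex_intro
    (fun e : R * R => e.1 < e.2 /\ arc v = angle_point @` `]e.1, e.2[) (a, b) h).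
exists false, (fun v => (e v).1), (fun v => (e v).2); split=> v.
  by have [] := eP v.
by have [_ ->] := eP v; congr image; apply/seteqP; split=> x;
  rewrite /= in_itv.
Qed.

Lemma arc_sub_circle (v : vertex G) : arc v `<=` circle.
Proof.
have [cl [lo [hi [_ arcE]]]] := arc_ends; rewrite arcE => z [x _ <-].
exact: circle_angle.
Qed.

Lemma has_total_total_upto n : has_total_of_size G n ->
  exists f, total_upto arc n f.
Proof.
case=> K [[_ KC] /card_set_bijP[g [gK ginj gsurj]]].
have [v0] := @vertex_nonempty R G.
have [f fP] : {f : nat -> vertex G & forall i, (i < n)%N -> K (f i) /\ g (f i) = i}.
  apply: (@choice _ _ (fun i v => (i < n)%N -> K v /\ g v = i)) => i.
  have [ni|ni] := ltnP i n; last by exists v0.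
  by have [v Kv gv] := gsurj i ni; exists v.
exists f => x; have := circle_angle x; rewrite -KC => -[v Kv vx].
have ni : (g v < n)%N := gK _ Kv; exists (g v) => //.
have [Kf gf] := fP _ ni.
by rewrite (ginj (f (g v)) v) ?inE.
Qed.

(** The image of [f] may have fewer than [n] elements, whence [m <= n]. *)
Lemma total_upto_has_total n f : total_upto arc n f ->
  exists2 m, (m <= n)%N & has_total_of_size G m.
Proof.
move=> tot; pose K := f @` `I_n.
have finK : finite_set K by apply: finite_image; apply: finite_II.
have [m Km] := (finite_setP K).1 finK; exists m.
  rewrite -card_le_II; apply: card_le_trans (card_image_le f `I_n).
  by have /card_eqPle[] := Km.
exists K; split=> //; split=> //; apply/seteqP; split=> z.
  by case=> v _; apply: arc_sub_circle.
move=> /angle_surj[x ->]; have [i ni h] := tot x.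
by exists (f i) => //; exists i.
Qed.

Lemma varrho_total n : varrho G = n -> (0 < n)%N ->
  (exists f, total_upto arc n f) /\
  forall m g, total_upto arc m g -> (n <= m)%N.
Proof.
rewrite /varrho; case: pselect => [h|_ <- //].
case: ex_minnP => k /asboolP hk kmin <- _.
split; first exact: has_total_total_upto.
move=> m g /total_upto_has_total[m' mm' hm']; apply: leq_trans mm'.
by apply: kmin; apply/asboolP.
Qed.

Lemma varrho_no_total : varrho G = 0%N -> forall m g, ~ total_upto arc m g.
Proof.
rewrite /varrho; case: pselect => [h|h _ m g].
  (* The value [0] cannot come from a total set, since the empty set does not cover the circle. *)
  case: ex_minnP => k /asboolP hk kmin k0; exfalso; move: hk; rewrite k0.
  by move=> /has_total_total_upto[f /(_ 0)[]].
by move=> /total_upto_has_total[m' _ hm']; apply: h; exists m'; apply/asboolP.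
Qed.

Lemma varrhoE n f : total_upto arc n f ->
  (forall m g, total_upto arc m g -> (n <= m)%N) -> varrho G = n.
Proof.
move=> tot tmin; have [m mn hm] := total_upto_has_total tot.
rewrite /varrho; case: pselect => [h|[]]; last by exists m; apply/asboolP.
case: ex_minnP => k /asboolP hk kmin; apply/eqP; rewrite eqn_leq.
apply/andP; split; first by apply: leq_trans mn; apply: kmin; apply/asboolP.
by have [g /tmin] := has_total_total_upto hk.
Qed.

Lemma varrho_eq0 : (forall m g, ~ total_upto arc m g) -> varrho G = 0%N.
Proof.
move=> notot; rewrite /varrho; case: pselect => // h.
by exfalso; have [n /asboolP /has_total_total_upto[f /notot]] := h.
Qed.

Lemma delta_ge0 : (0%:E <= delta G)%E.
Proof. by apply: hyperbolicity_ge0; apply: vertex_nonempty. Qed.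

Lemma delta_le : (delta G <= ((varrho G)./2%:R / 2 + 3 / 2)%:E)%E.
Proof.
have [cl [lo [hi [lo_hi arcE]]]] := arc_ends.
have [v0|vpos] := posnP (varrho G).
  rewrite v0 mul0r add0r.
  exact: (interval_hyperbolicity_le lo_hi arcE (varrho_no_total v0)).
have [[f tot] tmin] := varrho_total erefl vpos.
exact: (total_hyperbolicity_le lo_hi arcE tmin vpos tot).
Qed.

Lemma delta_ge : varrho G <> 1%N -> varrho G <> 2%N ->
  (((varrho G)%:R / 4)%:E <= delta G)%E.
Proof.
move=> v1 v2; have [v0|vpos] := posnP (varrho G).
  by rewrite v0 mul0r; apply: delta_ge0.
have [cl [lo [hi [lo_hi arcE]]]] := arc_ends.
have [[f tot] tmin] := varrho_total erefl vpos.
have v3 : (2 < varrho G)%N by lia.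
exact: (total_hyperbolicity_ge lo_hi arcE tmin v3 tot).
Qed.

End CircularArcGraphs.

(** * Arcs with endpoints on a regular grid *)

Section GridArcs.
Context {R : realType} {T : finType} (M : nat) (lo : T -> int) (len : T -> nat).
Context (M_gt0 : (0 < M)%N) (len_gt0 : forall v, (0 < len v)%N) (v0 : T).

Let cell : R := pi *+ 2 / M%:R.

(** The circle is cut into [M] cells and all ends are grid points, so that incidence becomes integer
    arithmetic. *)
Definition grid_arc (v : T) : set (R * R) :=
  angle_point @` `[cell * (lo v)%:~R, cell * (lo v + (len v)%:Z)%:~R].

Lemma cell_gt0 : 0 < cell.
Proof. by rewrite /cell divr_gt0 ?pi2_gt0// ltr0n. Qed.

Lemma cellM : cell * M%:R = pi *+ 2.
Proof. by rewrite /cell divfK// pnatr_eq0 -lt0n. Qed.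

Lemma grid_arc_closed v : closed_arc (grid_arc v).
Proof.
exists (cell * (lo v)%:~R), (cell * (lo v + (len v)%:Z)%:~R); split=> //.
by rewrite ltr_pM2l ?cell_gt0// ltr_int ltrDl ltz_nat.
Qed.

Definition grid_graph : circular_arc_graph R :=
  CircularArcGraph (inhabits v0) (or_introl grid_arc_closed).

Local Notation adj := (@arc_adj R grid_graph).

Lemma grid_arcP v (x : R) : grid_arc v (angle_point (cell * x)) <->
  exists z : int, (lo v)%:~R <= x + (M%:Z * z)%:~R <= (lo v + (len v)%:Z)%:~R.
Proof.
have u0 := cell_gt0; split.
  case=> y; rewrite /= in_itv /= => yb /angle_pointP[z yx]; exists z.
  have {}yx : y = cell * (x + (M%:Z * z)%:~R).
    by rewrite yx -cellM intrM mulrDr mulrA.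
  by move: yb; rewrite yx !ler_pM2l.
case=> z xb; exists (cell * (x + (M%:Z * z)%:~R)).
  by rewrite /= in_itv /= !ler_pM2l.
by apply/angle_pointP; exists z; rewrite -cellM intrM mulrDr mulrA.
Qed.

Lemma grid_adj u v : adj u v <-> u <> v /\ exists z : int,
  lo u <= lo v + (len v)%:Z + M%:Z * z /\ lo v + M%:Z * z <= lo u + (len u)%:Z.
Proof.
have u0 := cell_gt0; split.
  case=> uv [_ [[y xb <-] vx]]; split=> //; move: xb vx.
  have [x ->] : exists x, y = cell * x.
    by exists (cell^-1 * y); rewrite mulVKf// lt0r_neq0.
  rewrite /= in_itv /= !ler_pM2l// => xb /grid_arcP[z zb].
  exists (- z); split.
    rewrite -(ler_int R) intrD mulrN mulrNz; lra.
  rewrite -(ler_int R) intrD mulrN mulrNz; lra.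
case=> uv [z [h1 h2]]; split=> //.
(* The larger of the two lower ends is a grid point common to both arcs. *)
pose y := Num.max (lo u) (lo v + M%:Z * z).
exists (angle_point (cell * y%:~R)); split; apply/grid_arcP.
  by exists 0; rewrite mulr0 addr0 !ler_int le_max lexx /= ge_max h2; have := len_gt0 u; lia.
exists (- z); rewrite -intrD !ler_int mulrN /y; have := len_gt0 v; lia.
Qed.

(* Each arc contains the midpoints of at most [len v] of the [M] cells of the grid. *)
Lemma grid_total_ge m g : total_upto grid_arc m g ->
  exists A : {set T}, (#|A| <= m)%N /\ (M <= \sum_(v in A) len v)%N.
Proof.
move=> tot; exists [set g i | i : 'I_m]; split.
  by apply: leq_trans (leq_imset_card _ _) _; rewrite card_ord.
have [M' MM'] : exists M', M = M'.+1 by exists M.-1; lia.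
(* The cells of the arc [v], numbered modulo [M]. *)
pose S v : {set 'I_M'.+1} :=
  [set inord `|((lo v + (r : nat)%:Z) %% M%:Z)%Z|%N | r : 'I_(len v)].
have cover (j : 'I_M'.+1) : exists2 v, v \in [set g i | i : 'I_m] & j \in S v.
  have [i im] := tot (cell * ((j : nat)%:R + 1/2)).
  move=> /grid_arcP[z zb]; exists (g i).
    by apply/imsetP; exists (Ordinal im).
  pose q : int := (j : nat)%:Z + M%:Z * z.
  have qE : (j : nat)%:R + 1/2 + (M%:Z * z)%:~R = q%:~R + 1/2 :> R.
    by rewrite intrD addrAC.
  have h1 : lo (g i) < q + 1.
    by rewrite -(ltr_int R) intrD; move: zb; rewrite qE; lra.
  have h2 : q < lo (g i) + (len (g i))%:Z.
    by rewrite -(ltr_int R); move: zb; rewrite qE; lra.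
  have rl : (`|q - lo (g i)|%N < len (g i))%N by lia.
  apply/imsetP; exists (Ordinal rl) => //=; apply: val_inj => /=.
  have -> : lo (g i) + `|q - lo (g i)|%N%:Z = q by lia.
  have jM : (j < M)%N by rewrite MM' ltn_ord.
  by rewrite /q addrC mulrC modzMDl modz_small ?inordK -?MM' //= jM.
rewrite MM'; rewrite -[X in (X <= _)%N]card_ord -sum1_card.
(* Double counting of the pairs of a cell and a chosen arc containing it. *)
apply: (@leq_trans (\sum_(j : 'I_M'.+1) \sum_(v in [set g i | i : 'I_m]) (j \in S v))).
  apply: leq_sum => j _; have [v vA jv] := cover j.
  by rewrite (bigD1 v) //= jv.
rewrite exchange_big /=; apply: leq_sum => v _.
rewrite -big_mkcond /= sum1_card; apply: leq_trans (leq_imset_card _ _) _.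
by rewrite card_ord.
Qed.

Lemma grid_tiling_total n (g : nat -> T) (f : nat -> int) :
  (forall i, (i < n)%N -> lo (g i) = f i /\ lo (g i) + (len (g i))%:Z = f i.+1) ->
  f n = f 0%N + M%:Z -> total_upto grid_arc n g.
Proof.
move=> fg fn x; have u0 := cell_gt0.
have [y ->] : exists y, x = cell * y.
  by exists (cell^-1 * x); rewrite mulVKf// lt0r_neq0.
have M0 : 0 < M%:R :> R by rewrite ltr0n.
pose z := - Num.floor ((y - (f 0%N)%:~R) / M%:R).
have zE : (M%:Z * z)%:~R = M%:R * z%:~R :> R by rewrite intrM.
have yz : (f 0%N)%:~R <= y + (M%:Z * z)%:~R < (f n)%:~R.
  have := Num.Theory.floor_itv ((y - (f 0%N)%:~R) / M%:R) => /andP[].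
  rewrite ler_pdivlMr// ltr_pdivrMr// zE /z fn !intrD mulrNz; nra.
have : exists2 i, (i < n)%N & (f i)%:~R <= y + (M%:Z * z)%:~R < (f i.+1)%:~R.
  case/andP: yz => f0; clear fn; elim: n fg => [|k IH] fg fk; first lra.
  have [h|h] := ltP (y + (M%:Z * z)%:~R) (f k)%:~R.
    by have [|i ik hi] := IH _ h; [move=> i ik; apply: fg; lia|exists i; [lia|]].
  by exists k => //; rewrite h.
case=> i ni hi; exists i => //; apply/grid_arcP; exists z.
by have [-> ->] := fg _ ni; lra.
Qed.

(** A total set of [m] arcs has length at least [M] and at most [d * m] plus the excess over [d] of
    all arcs; this forces [n <= m]. *)
Lemma grid_tiling_varrho n (g : nat -> T) (f : nat -> int) d :
  (forall i, (i < n)%N -> lo (g i) = f i /\ lo (g i) + (len (g i))%:Z = f i.+1) ->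
  f n = f 0%N + M%:Z -> (0 < d)%N ->
  (\sum_v (len v - d) + d * n <= M)%N -> varrho grid_graph = n.
Proof.
move=> fg fn d0 extra; apply: (@varrhoE R grid_graph n g).
  exact: grid_tiling_total fg fn.
move=> m h /grid_total_ge[A [Am MA]].
have : (\sum_(v in A) len v <= \sum_v (len v - d) + d * #|A|)%N.
  apply: (@leq_trans (\sum_(v in A) (len v - d + d))).
    by apply: leq_sum => v _; lia.
  rewrite big_split /= sum_nat_const mulnC leq_add2r.
  by rewrite [X in (_ <= X)%N](bigID (mem A)) /= leq_addr.
have : (d * #|A| <= d * m)%N by rewrite leq_mul2l Am orbT.
move=> h1 h2; have : (d * n <= d * m)%N by lia.
by rewrite leq_mul2l; lia.
Qed.

Lemma grid_varrho0 : (\sum_v len v < M)%N -> varrho grid_graph = 0%N.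
Proof.
move=> small; apply: (@varrho_eq0 R grid_graph) => m g /grid_total_ge[A [_ MA]].
have : (\sum_(v in A) len v <= \sum_v len v)%N.
  by rewrite [X in (_ <= X)%N](bigID (mem A)) /= leq_addr.
lia.
Qed.

End GridArcs.

(** * Extremal graphs *)

Section PointGraph.
Context {R : realType}.

Definition point_graph : circular_arc_graph R :=
  @grid_graph R 'I_1 2 (fun=> 0) (fun=> 1%N) (ltn0Sn 1) (fun=> ltn0Sn 0) ord0.

Lemma point_varrho : varrho point_graph = 0%N.
Proof. by apply: grid_varrho0; rewrite sum_nat_const card_ord. Qed.

Lemma point_delta : delta point_graph = 0%:E.
Proof.
apply/le_anti/andP; split; last exact: delta_ge0.
apply: subsingleton_hyperbolicity => [u v []//|u v].
by rewrite (ord1 u) (ord1 v).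
Qed.

End PointGraph.

Section Rings.
Context {R : realType} (k : nat).
Local Notation n := k.+1.

(** One arc for each of the [n] cells: a cycle for [n > 2], a single vertex or edge for
    [n = 1, 2]. *)
Definition ring_graph : circular_arc_graph R :=
  @grid_graph R 'I_n n (fun i => (i : nat)%:Z) (fun=> 1%N)
    (ltn0Sn k) (fun=> ltn0Sn 0) ord0.

Local Notation adj := (@arc_adj R ring_graph).
Local Notation c := (fun i => inord (i %% n)%N : 'I_n).

Lemma ring_varrho : varrho ring_graph = n.
Proof.
apply: (@grid_tiling_varrho _ _ _ _ _ _ _ _ n (fun i => inord i) (fun i => i%:Z) 1%N) => //.
  by move=> i ik; rewrite inordK//; split=> //; lia.
by rewrite big1 ?mul1n.
Qed.

Let adjC (u v : 'I_n) : adj u v -> adj v u :=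
  @arcs_adjC R _ (Defs.arc (c := ring_graph)) u v.
Let adjN (u v : 'I_n) : adj u v -> u <> v :=
  @arcs_adjN R _ (Defs.arc (c := ring_graph)) u v.

Lemma ring_delta1 : k = 0%N -> delta ring_graph = 0%:E.
Proof.
move=> k0; apply/le_anti/andP; split; last exact: delta_ge0.
apply: (subsingleton_hyperbolicity adjN) => u v; apply: val_inj => /=.
by have := ltn_ord u; have := ltn_ord v; lia.
Qed.

Lemma ring_adj (u v : 'I_n) : adj u v <-> u <> v /\ (v = c u.+1 \/ u = c v.+1).
Proof.
have un := ltn_ord u; have vn := ltn_ord v.
have cval i : (c i : nat) = (i %% n)%N by rewrite inordK// ltn_pmod.
split.
  move=> /grid_adj[uv [z [/= h1 h2]]]; split=> //.
  have uv' : (u : nat) <> v by move=> h; apply: uv; apply: val_inj.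
  have z1 : z <= 1 by nia.
  have z2 : -1 <= z by nia.
  have [z0|[z0|z0]] : z = 0 \/ z = 1 \/ z = -1 by lia.
  - have [h|h] : (v : nat) = u.+1 \/ (u : nat) = v.+1 by lia.
      by left; apply: val_inj; rewrite /= cval modn_small; lia.
    by right; apply: val_inj; rewrite /= cval modn_small; lia.
  - left; apply: val_inj; rewrite /= cval.
    have -> : u.+1 = n by lia.
    by rewrite modnn; lia.
  - right; apply: val_inj; rewrite /= cval.
    have -> : v.+1 = n by lia.
    by rewrite modnn; lia.
have next (a : 'I_n) : exists z : int, (a : nat)%:Z <= (c a.+1 : nat)%:Z + 1 + n%:Z * z /\
    (c a.+1 : nat)%:Z + n%:Z * z <= (a : nat)%:Z + 1.
  rewrite cval; have [h|h] := ltnP a.+1 n.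
    by exists 0; rewrite modn_small//; lia.
  have an := ltn_ord a; exists 1; have -> : a.+1 = n by lia.
  by rewrite modnn; lia.
case=> uv [h|h]; apply/grid_adj; split=> //=.
  by have [z hz] := next u; exists z; rewrite h; lia.
have [z hz] := next v; exists (- z); rewrite h mulrN; lia.
Qed.

Lemma ring_delta2 : k = 1%N -> delta ring_graph = 0%:E.
Proof.
move=> k1; apply/le_anti/andP; split; last exact: delta_ge0.
have n2 : (1 < n)%N by lia.
apply: (@segment_hyperbolicity _ _ _ adjN (ord0 : 'I_n) (inord 1 : 'I_n)).
  apply/ring_adj; split; last by left; congr inord; rewrite modn_small.
  by move=> /(congr1 val); rewrite /= inordK.
move=> v; have vn := ltn_ord v.
have [h|h] : (v : nat) = 0%N \/ (v : nat) = 1%N by lia.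
  by left; apply: val_inj.
by right; apply: val_inj; rewrite /= inordK.
Qed.

Lemma ring_delta : (1 < k)%N -> delta ring_graph = (n%:R / 4)%:E.
Proof.
move=> k1; apply/le_anti/andP; split; last first.
  by rewrite -ring_varrho; apply: delta_ge; rewrite ring_varrho; lia.
have cval i : (c i : nat) = (i %% n)%N by rewrite inordK// ltn_pmod.
have cK (u : 'I_n) : c u = u.
  by apply: val_inj; rewrite /= cval modn_small.
have cN i : c (i + n)%N = c i by rewrite modnDr.
have c_adj i : adj (c i) (c i.+1).
  apply/ring_adj; split; last first.
    by left; congr inord; rewrite cval -[in RHS]addn1 modnDml addn1.
  move=> /(congr1 val); rewrite /= !cval -[i in LHS]addn0 -[i.+1]addn1 => /eqP.
  by rewrite eqn_modDl mod0n modn_small; lia.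
have ptE x : graph_points adj x -> exists2 s, 0 <= s <= n%:R & x = walk_point (R := R) c s.
  case=> [[v ->]|[u [v [t [uv t01 ->]]]]].
    exists (v : nat)%:R; last by rewrite walk_point_nat cK.
    by rewrite ler0n ler_nat ltnW.
  have edge (a b : 'I_n) (r : R) : b = c a.+1 -> 0 <= r <= 1 ->
      exists2 s, 0 <= s <= n%:R & edge_point a b r = walk_point c s.
    move=> -> r01; exists ((a : nat)%:R + r).
      have : ((a.+1)%:R : R) <= n%:R by rewrite ler_nat.
      have : (0 : R) <= (a : nat)%:R by rewrite ler0n.
      by rewrite -natr1; lra.
    rewrite (@walk_pointE R _ c ((a : nat)%:R + r) a); last by rewrite -natr1; lra.
    by rewrite cK; congr edge_point; ring.
  have /ring_adj[_ [h|h]] := uv; first exact: edge.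
  by rewrite edge_pointC; apply: edge => //; lra.
(* The metric graph is nothing but the cycle, whose diameter is at most [n / 2]. *)
have -> : n%:R / 4 = n%:R / 2 / 2 :> R by lra.
apply: hyperbolicity_le_half_diam; first by rewrite divr_ge0.
move=> x y /ptE[s sn ->] /ptE[t tn ->].
exact: (walk_point_diam c_adj).
Qed.

End Rings.

Section TwinPath.
Context {R : realType}.

Let lo (i : 'I_6) : int := if (i <= 3)%N then (i : nat)%:Z else 6 - (i : nat)%:Z.

(* The path [0 - 1 - 2 - 3] with its two inner vertices doubled. *)
Definition twin_path : circular_arc_graph R :=
  @grid_graph R 'I_6 8 lo (fun=> 1%N) (ltn0Sn 7) (fun=> ltn0Sn 0) ord0.

Local Notation adj := (@arc_adj R twin_path).
Local Notation c := (fun i => inord (i %% 6)%N : 'I_6).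

Lemma twin_path_varrho : varrho twin_path = 0%N.
Proof. by apply: grid_varrho0; rewrite sum_nat_const card_ord. Qed.

Let adjC (u v : 'I_6) : adj u v -> adj v u :=
  @arcs_adjC R _ (Defs.arc (c := twin_path)) u v.
Let adjN (u v : 'I_6) : adj u v -> u <> v :=
  @arcs_adjN R _ (Defs.arc (c := twin_path)) u v.

Lemma twin_path_lo (u v : 'I_6) : adj u v -> lo v <= lo u + 1.
Proof.
move=> /grid_adj[_ [z []]]; rewrite /lo.
have := ltn_ord u; have := ltn_ord v.
by case: ifP; case: ifP; lia.
Qed.

Lemma twin_path_delta : delta twin_path = (3 / 2)%:E.
Proof.
apply/le_anti/andP; split.
  by have := delta_le twin_path; rewrite twin_path_varrho mul0r add0r.
have cval i : (c i : nat) = (i %% 6)%N by rewrite inordK// ltn_pmod.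
have cN i : c (i + 6)%N = c i by rewrite modnDr.
have c_adj i : adj (c i) (c i.+1).
  have i6 : (i %% 6 < 6)%N by rewrite ltn_pmod.
  have iS : (i.+1 %% 6 = (i %% 6).+1 %% 6)%N by rewrite -[in RHS]addn1 modnDml addn1.
  apply/grid_adj; rewrite /lo !cval iS; split.
    move=> /(congr1 val); rewrite /= !cval.
    by case: (i %% 6)%N i6 => [|[|[|[|[|[|]]]]]].
  by exists 0; case: (i %% 6)%N i6 => [|[|[|[|[|[|]]]]]].
have lo_c i : (i < 6)%N -> lo (c i) = if (i <= 3)%N then i%:Z else 6 - i%:Z.
  by move=> i6; rewrite /lo cval modn_small.
have near t (j a b : nat) : (a%:R : R) <= t <= b%:R -> `|t - j%:R| <= 1 ->
    (a <= j.+1)%N /\ (j <= b.+1)%N.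
  move=> tab; rewrite ler_norml => tj; split; rewrite -(ler_nat R) -natr1; lra.
(* The six vertices in order form a closed walk; its bigon joins the ends [0] and [3] of the
   path. *)
have -> : 3 / 2 = 6%:R / 4 :> R by lra.
apply: (bigon_hyperbolicity_ge c_adj (s0 := 0)) => //.
  move=> l; rewrite add0r; have -> : 6%:R / 2 = 3%:R :> R by lra.
  apply: dle_dist_ge.
  (* This potential is twice the distance to the vertex [0]. *)
  apply: (@dist_walk_point_ge R _ _ adjC adjN c c_adj (fun v => lo v * 2)) => //.
  - by move=> u v /twin_path_lo; lia.
  - by rewrite truncn0 (lo_c 0%N)// intrM; lra.
  - by rewrite truncn0 (lo_c 1%N)// intrM; lra.
  - move=> j tj; have [] := near 3 j 3%N 3%N _ tj; first by rewrite lexx.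
    move: tj; move: j => [|[|[|[|[|]]]]] //= _ _ _.
    + by rewrite (lo_c 2%N)// intrM ger0_norm; lra.
    + by rewrite (lo_c 3%N)// intrM subrr normr0; lra.
    + by rewrite (lo_c 4%N)// intrM ler0_norm; lra.
  - exists 3%N; first by rewrite subrr normr0.
    by rewrite truncn0; split=> /(congr1 val); rewrite /= !inordK.
move=> t l; rewrite !add0r => t36; apply: dle_dist_ge.
have tr : Num.truncn (6%:R / 4 : R) = 1%N by apply/eqP; rewrite truncn_eq; lra.
(* Twice the distance to the midpoint of the edge from [1] to [2]. *)
pose psi (v : 'I_6) : int := if ((v : nat) == 1%N) || ((v : nat) == 2%N) then 1 else 3.
apply: (@dist_walk_point_ge R _ _ adjC adjN c c_adj psi); rewrite ?tr; try lra.
- by move=> u v _; rewrite /psi; case: ifP; case: ifP.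
- by rewrite /psi cval /=; lra.
- by rewrite /psi cval /=; lra.
- move=> j tj; have [] := near t j 3%N 6%N _ tj; first by lra.
  have := normr_ge0 (t - j%:R); have := ler_norm (t - j%:R).
  have := ler_norm (j%:R - t); rewrite (distrC j%:R).
  by rewrite /psi cval; move: j tj => [|[|[|[|[|[|[|[|]]]]]]]] //= _; lra.
- have t0 : 0 <= t by lra.
  have tb := truncn_bounds t0; exists (Num.truncn t); first by rewrite ger0_norm; lra.
  have h1 : (3 < (Num.truncn t).+1)%N by rewrite -(ltr_nat R) -natr1; lra.
  have h2 : (Num.truncn t <= 6)%N by rewrite -(ler_nat R); lra.
  split=> /(congr1 val); rewrite /= !cval /=; move: h1 h2;
    by case: (Num.truncn t) => [|[|[|[|[|[|[|]]]]]]].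
Qed.

End TwinPath.

(** * Graphs attaining the upper bound for positive [varrho] *)

Section Extremal.
Context {R : realType} (k : nat).
Local Notation n := k.+1.
Local Notation m := (n./2).
Local Notation h := (m./2).
Local Notation N' := (2 * m + 5)%N.
Local Notation N := N'.+1.
Local Notation T := ('I_N + 'I_n)%type.

(* [N = 2 m + 6] short arcs form a long cycle, and [n] arcs, the [j]-th one
   reaching from [cut j] to [cut j.+1], form a tiling. The long cycle carries the
   triangle with vertices the midpoint of the edge [0 1] and its antipode, which
   the arcs [0] and [m] of the tiling cover; the jumps of [cut] keep the shortcuts
   through the tiling from being shorter than the long cycle on one half of it. *)
Definition cut (j : nat) : int :=
  if (j == 0)%N then 2 * n%:Z - 4 * m%:Z - 5
  else if (j <= h)%N then 2 * j%:Z + 1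
  else if (j <= m)%N then 2 * j%:Z + 3
  else 2 * j%:Z + 7.

Definition extremal_lo (v : T) : int := match v with
  | inl i => 2 * (i : nat)%:Z - 2
  | inr j => cut j end.

Definition extremal_len (v : T) : nat := match v with
  | inl _ => 2
  | inr j => `|cut j.+1 - cut j|%N end.

Local Notation lo := extremal_lo.
Local Notation len := extremal_len.

Lemma cut_step j : (j < n)%N -> cut j + 2 <= cut j.+1.
Proof.
rewrite /cut /=; case: j => [|j] jn /=.
  by case: ifP => _; [lia|]; case: ifP; lia.
by do 4?[case: ifP => ?]; lia.
Qed.

Lemma cut_homo i j : (i <= j <= n)%N -> cut i + 2 * (j%:Z - i%:Z) <= cut j.
Proof.
case/andP; elim: j => [|j IH] ij jn; first by have -> : i = 0%N by [lia]; lia.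
have [->|ij'] := eqVneq i j.+1; first lia.
by have := cut_step jn; have := IH _ (ltnW jn); lia.
Qed.

Lemma extremal_len_gt0 v : (0 < len v)%N.
Proof. by case: v => [//|j] /=; have := cut_step (ltn_ord j); lia. Qed.

Definition extremal_graph : circular_arc_graph R :=
  @grid_graph R T (2 * N) lo len (ltn0Sn _) extremal_len_gt0 (inl ord0).

Local Notation adj := (@arc_adj R extremal_graph).
Local Notation c := (fun i => inl (inord (i %% N)%N) : T).

Lemma cut_period : cut n = cut 0 + (2 * N)%N%:Z.
Proof. by rewrite /cut /=; do 2?[case: ifP => ?]; lia. Qed.

Lemma extremal_varrho : varrho extremal_graph = n.
Proof.
have cutn := cut_period.
apply: (@grid_tiling_varrho _ _ _ _ _ _ _ _ n (fun j => inr (inord j)) cut 2) => //.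
  move=> j jn; rewrite /lo /len /= inordK//; split=> //.
  by have := cut_step jn; lia.
(* The short arcs have no excess over [d = 2]; the excesses of the tiling telescope. *)
rewrite big_sumType /= big1// add0n.
suff : forall l, (l <= n)%N ->
    (\sum_(j < l) (`|cut j.+1 - cut j| - 2))%N%:Z = cut l - cut 0 - 2 * l%:Z.
  move=> /(_ n (leqnn n)); rewrite cutn; move: (bigop _ _ _) => S; lia.
elim=> [|l IH] ln; first by rewrite big_ord0; lia.
rewrite big_ord_recr /= PoszD IH; last exact: ltnW.
by have := cut_step ln; lia.
Qed.

Let adjC (u v : T) : adj u v -> adj v u :=
  @arcs_adjC R _ (Defs.arc (c := extremal_graph)) u v.
Let adjN (u v : T) : adj u v -> u <> v :=
  @arcs_adjN R _ (Defs.arc (c := extremal_graph)) u v.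

Lemma extremal_adj (u v : T) : adj u v -> u <> v /\
  exists2 z : int, z = 0 \/ z = 4 * m%:Z + 12 \/ z = - (4 * m%:Z + 12) &
    lo u <= lo v + (len v)%:Z + z /\ lo v + z <= lo u + (len u)%:Z.
Proof.
move=> /grid_adj[uv [z [h1 h2]]]; split=> //.
exists ((2 * N)%N%:Z * z) => //.
(* All these lifts lie in an interval shorter than two turns, so only the windings [0], [1] and
   [- 1] remain. *)
have bound w : - 5 <= lo w /\ lo w + (len w)%:Z <= 4 * m%:Z + 10.
  case: w => [i|j]; rewrite /lo /len; first by have := ltn_ord i; lia.
  have jn := ltn_ord j; have := cut_step jn => jc.
  have -> : cut j + `|cut j.+1 - cut j|%N%:Z = cut j.+1 by lia.
  rewrite /cut /=; split; do 3?[case: ifP => ?]; lia.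
have [u1 u2] := bound u; have [v1 v2] := bound v.
have z1 : z <= 1 by nia.
have z2 : - 1 <= z by nia.
have [->|[->|->]] : z = 0 \/ z = 1 \/ z = - 1 by lia.
all: lia.
Qed.

(** The cuts increase strictly over one turn, so tiles meet only their cyclic neighbours. *)
Lemma extremal_adj_tiling (j j' : 'I_n) : adj (inr j) (inr j') ->
  [\/ (j' = j.+1 :> nat), (j = j'.+1 :> nat), j = 0%N :> nat /\ j' = k :> nat |
      j' = 0%N :> nat /\ j = k :> nat].
Proof.
move=> /extremal_adj[jj [z hz]]; rewrite /lo /len.
have jn := ltn_ord j; have jn' := ltn_ord j'.
have jj' : (j : nat) <> j' by move=> e; apply: jj; congr inr; apply: val_inj.
have jc := cut_step jn; have jc' := cut_step jn'.
have -> : cut j + `|cut j.+1 - cut j|%N%:Z = cut j.+1 by lia.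
have -> : cut j' + `|cut j'.+1 - cut j'|%N%:Z = cut j'.+1 by lia.
have gap a b : (a < b <= n)%N -> cut a < cut b.
  by move=> ab; have := @cut_homo a b; lia.
have per : cut n = cut 0 + (4 * m%:Z + 12) by rewrite cut_period; lia.
case: hz => [->|[->|->]] [h1 h2].
- have : (j' <= j.+1)%N by rewrite leqNgt; apply/negP => ?; have := gap j.+1 j'; lia.
  have : (j <= j'.+1)%N by rewrite leqNgt; apply/negP => ?; have := gap j'.+1 j; lia.
  move=> jle j'le; have [h|h] : (j' = j.+1 :> nat) \/ (j = j'.+1 :> nat) by lia.
    by constructor 1.
  by constructor 2.
- have j'0 : j' = 0%N :> nat by have := gap 0%N j'; have := @cut_homo j.+1 n; lia.
  constructor 4; split=> //; apply/eqP; rewrite -eqSS; apply/eqP.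
  by rewrite j'0 in h2; have := gap j.+1 n; lia.
- have j0 : j = 0%N :> nat by have := gap 0%N j; have := @cut_homo j'.+1 n; lia.
  constructor 3; split=> //; apply/eqP; rewrite -eqSS; apply/eqP.
  by rewrite j0 in h1; have := gap j'.+1 n; lia.
Qed.

(* Twice the distance to the midpoint of the edge [0 1] of the long cycle. *)
Definition extremal_phi (v : T) : int := match v with
  | inl i => if (i == 0 :> nat)%N then 1
             else if (i <= m + 3)%N then 2 * (i : nat)%:Z - 1
             else 2 * (N - i)%N%:Z + 1
  | inr j => if (j <= m)%N then 2 * (j : nat)%:Z + 3 else 2 * (n - j)%N%:Z + 3 end.

(* Twice the distance to the middle of the first half of the long cycle, as far
   as it lies on that half. *)
Definition extremal_psi (v : T) : int := match v with
  | inl i => if (0 < i <= m + 3)%N then `|2 * (i : nat)%:Z - m%:Z - 4|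
             else m%:Z + 4
  | inr j => if (j <= m)%N then 2 + `|2 * (j : nat)%:Z - m%:Z| else m%:Z + 4 end.

Local Notation phi := extremal_phi.
Local Notation psi := extremal_psi.

(** Between two tiles only cyclic neighbours matter; the other pairs are compared through the values
    of [cut], whose jumps are chosen for this. *)
Lemma extremal_phi_lip u v : adj u v -> phi v <= phi u + 2.
Proof.
case: u v => [i|j] [i'|j'] uv; last 1 first.
  have := ltn_ord j; have := ltn_ord j'; rewrite /phi.
  by case: (extremal_adj_tiling uv) => h; do 2?[case: ifP => ?]; lia.
all: have [_ [z hz []]] := extremal_adj uv; move: hz; rewrite /lo /len /phi.
- have := ltn_ord i; have := ltn_ord i'; do 4?[case: ifP => ?]; lia.
- have := ltn_ord i; have jn := ltn_ord j'; have jc := cut_step jn.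
  have -> : cut j' + `|cut j'.+1 - cut j'|%N%:Z = cut j'.+1 by lia.
  move: jc; rewrite /cut /=; do 8?[case: ifP => ?]; lia.
- have := ltn_ord i'; have jn := ltn_ord j; have jc := cut_step jn.
  have -> : cut j + `|cut j.+1 - cut j|%N%:Z = cut j.+1 by lia.
  move: jc; rewrite /cut /=; do 8?[case: ifP => ?]; lia.
Qed.

Lemma extremal_psi_lip u v : adj u v -> psi v <= psi u + 2.
Proof.
case: u v => [i|j] [i'|j'] uv; last 1 first.
  have := ltn_ord j; have := ltn_ord j'; rewrite /psi.
  by case: (extremal_adj_tiling uv) => h; do 2?[case: ifP => ?]; lia.
all: have [_ [z hz []]] := extremal_adj uv; move: hz; rewrite /lo /len /psi.
- have := ltn_ord i; have := ltn_ord i'; do 2?[case: ifP => ?]; lia.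
- have := ltn_ord i; have jn := ltn_ord j'; have jc := cut_step jn.
  have -> : cut j' + `|cut j'.+1 - cut j'|%N%:Z = cut j'.+1 by lia.
  move: jc; rewrite /cut /=; do 8?[case: ifP => ?]; lia.
- have := ltn_ord i'; have jn := ltn_ord j; have jc := cut_step jn.
  have -> : cut j + `|cut j.+1 - cut j|%N%:Z = cut j.+1 by lia.
  move: jc; rewrite /cut /=; do 8?[case: ifP => ?]; lia.
Qed.

Lemma extremal_adj_succ i : adj (c i) (c i.+1).
Proof.
have iN : (i %% N < N)%N by rewrite ltn_pmod.
have cval j : ((inord (j %% N) : 'I_N) : nat) = (j %% N)%N by rewrite inordK// ltn_pmod.
have iS : (i.+1 %% N = (i %% N).+1 %% N)%N by rewrite -[in RHS]addn1 modnDml addn1.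
have [iSN|iSN] := ltnP (i %% N).+1 N.
  have iS' : (i.+1 %% N = (i %% N).+1)%N by rewrite iS modn_small.
  apply/grid_adj; split.
    by case=> /(congr1 val); rewrite /= !cval iS'; lia.
  by exists 0; rewrite /lo /len !cval iS'; lia.
have iE : (i %% N = N')%N by lia.
have iS' : (i.+1 %% N = 0)%N by rewrite iS iE modnn.
apply/grid_adj; split.
  by case=> /(congr1 val); rewrite /= !cval iS' iE; lia.
by exists 1; rewrite /lo /len !cval iS' iE; lia.
Qed.

Lemma extremal_delta : delta extremal_graph = (m%:R / 2 + 3 / 2)%:E.
Proof.
apply/le_anti/andP; split.
  by have := delta_le extremal_graph; rewrite extremal_varrho.
have cval j : ((inord (j %% N) : 'I_N) : nat) = (j %% N)%N by rewrite inordK// ltn_pmod.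
have cN i : c (i + N)%N = c i by rewrite modnDr.
have m0 : 0 <= m%:R :> R by rewrite ler0n.
have NE : N%:R = 2 * m%:R + 6 :> R.
  by rewrite -natr1 natrD natrM; lra.
have -> : m%:R / 2 + 3 / 2 = N%:R / 4 :> R by rewrite NE; lra.
have phi_c j : (0 < j <= m + 3)%N -> phi (c j) = 2 * j%:Z - 1.
  by move=> jm; rewrite /phi cval modn_small; last lia; do 2?[case: ifP => ?]; lia.
have phi_c' : phi (c (m + 4)%N) = 2 * m%:Z + 5.
  by rewrite /phi cval modn_small; last lia; do 2?[case: ifP => ?]; lia.
have phi_c0 : phi (c 0%N) = 1 by rewrite /phi cval mod0n.
have psi_c j : (0 < j <= m + 3)%N -> psi (c j) = `|2 * j%:Z - m%:Z - 4|.
  by move=> jm; rewrite /psi cval modn_small ?jm//; lia.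
have psi_c' j : (m + 3 < j <= N)%N -> psi (c j) = m%:Z + 4.
  move=> jm; have [jN|jN] := ltnP j N.
    by rewrite /psi cval modn_small//; case: ifP; lia.
  have -> : j = N by lia.
  by rewrite /psi cval modnn.
have near t (j a b : nat) : (a%:R : R) <= t < b%:R -> `|t - j%:R| <= 1 ->
    (a <= j.+1)%N /\ (j <= b)%N.
  move=> tab; rewrite ler_norml => tj; split.
    by rewrite -(ler_nat R) -natr1; lra.
  by rewrite -ltnS -(ltr_nat R) -natr1; lra.
(* The midpoint of the edge [0 1] is at [1/2]; as [N / 2 = m + 3], its antipode is the midpoint of
   the edge from [m + 3] to [m + 4]. *)
apply: (bigon_hyperbolicity_ge extremal_adj_succ (s0 := 1/2)) => //.
  move=> l; have -> : 1/2 + N%:R / 2 = (m + 3)%N%:R + 1/2 :> R.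
    by rewrite NE natrD; lra.
  have tr : Num.truncn (1/2 : R) = 0%N by apply/eqP; rewrite truncn_eq; lra.
  apply: dle_dist_ge.
  apply: (@dist_walk_point_ge R _ _ adjC adjN c extremal_adj_succ phi);
    rewrite ?tr ?phi_c0.
  - by lra.
  - by rewrite natrD; lra.
  - exact: extremal_phi_lip.
  - by lra.
  - by rewrite phi_c; [lra|lia].
  - move=> j tj; have [h1 h2] : (m + 3 <= j.+1)%N /\ (j <= m + 4)%N.
      by apply: near tj; rewrite !natrD; lra.
    have [jE|[jE|jE]] : (j = m + 2 \/ j = m + 3 \/ j = m + 4)%N by lia.
    + move: tj; rewrite jE !natrD ger0_norm; lra.
    + rewrite jE phi_c; last lia.
      rewrite intrB intrM -[(m + 3)%N%:Z%:~R]/((m + 3)%N%:R).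
      rewrite addrAC subrr add0r ger0_norm; last lra.
      by rewrite NE natrD; lra.
    + rewrite jE phi_c' intrD intrM -[m%:Z%:~R]/(m%:R).
      rewrite NE !natrD ler0_norm; lra.
  - exists (m + 3)%N; first by rewrite addrAC subrr add0r ger0_norm; lra.
    by split=> /(congr1 phi); rewrite ?phi_c0 phi_c ?phi_c; lia.
move=> t l tN; apply: dle_dist_ge.
(* The middle [1/2 + N / 4] equals [(m + 4) / 2]: it is the vertex [i] for [m] even and the midpoint
   of an edge for [m] odd; [b] is this parity. *)
have [i [b [b1 ib]]] : exists i b, (b <= 1)%N /\ (i * 2 + b = m + 4)%N.
  by exists (m + 4)./2, (odd m); lia.
have iE : (i%:R : R) = (m%:R + 4 - b%:R) / 2.
  have : ((i * 2 + b)%N%:R : R) = (m + 4)%N%:R by rewrite ib.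
  by rewrite !natrD natrM; lra.
have b01 : 0 <= (b%:R : R) <= 1 by rewrite ler0n (ler_nat R b 1).
have tr : Num.truncn (1/2 + N%:R / 4 : R) = i.
  by apply/eqP; rewrite NE truncn_eq -?[i.+1%:R]natr1 ?iE; lra.
apply: (@dist_walk_point_ge R _ _ adjC adjN c extremal_adj_succ psi); rewrite ?tr.
- by lra.
- by lra.
- exact: extremal_psi_lip.
- rewrite psi_c; last lia.
  have -> : `|2 * i%:Z - m%:Z - 4| = b%:Z :> int by lia.
  by rewrite NE iE -[b%:Z%:~R]/(b%:R); lra.
- rewrite psi_c; last lia.
  have -> : `|2 * i.+1%:Z - m%:Z - 4| = 2 - b%:Z :> int by lia.
  by rewrite NE iE intrB -[b%:Z%:~R]/(b%:R); lra.
- move=> j tj; have [h1 h2] : (m + 3 <= j.+1)%N /\ (j <= N + 1)%N.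
    by apply: near tj; rewrite natrD natrD NE; lra.
  have t1 := ler_norm (t - j%:R); have t2 := ler_norm (j%:R - t).
  rewrite (distrC j%:R) in t2.
  (* The index [m + 2] is too far from [t], and [N + 1] is the vertex [1] again. *)
  have [jE|[jE|[jE|jE]]] : (j = m + 2 \/ j = m + 3 \/ m + 3 < j <= N \/ j = N + 1)%N.
    by clear - h1 h2; lia.
  + by move: t1 tj; rewrite jE natrD; lra.
  + rewrite jE psi_c; last by clear; lia.
    have -> : `|2 * (m + 3)%N%:Z - m%:Z - 4| = m%:Z + 2 :> int by clear; lia.
    move: t1; rewrite jE natrD intrD -[m%:Z%:~R]/(m%:R) NE; lra.
  + by rewrite psi_c'// intrD -[m%:Z%:~R]/(m%:R) NE; have := normr_ge0 (t - j%:R); lra.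
  + have -> : psi (c j) = m%:Z + 2.
      have := cN 1%N; rewrite [(1 + N)%N]addnC -jE => ->.
      by rewrite psi_c; clear; lia.
    move: t2; rewrite jE natrD intrD -[m%:Z%:~R]/(m%:R); lra.
(* A vertex near [t] off the base edge: there [psi] is [m + 4], against at most [2] at the ends of
   the base edge. *)
- have psi_big j : (m + 3 < j <= N)%N -> c j <> c i /\ c j <> c i.+1.
    move=> jm; split=> /(congr1 psi); rewrite psi_c'// psi_c;
      by clear - jm ib b1; lia.
  have [tm|tm] := ltP t (m + 4)%N%:R.
    exists (m + 4)%N; last by apply: psi_big; lia.
    by move: tm; rewrite natrD => tm; rewrite ler0_norm; lra.
  have t0 : 0 <= t by lra.
  have tb := truncn_bounds t0; exists (Num.truncn t); first by rewrite ger0_norm; lra.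
  apply: psi_big; apply/andP; split.
    by rewrite -ltnS -(ltr_nat R) -natr1; move: tm; rewrite !natrD -natr1; lra.
  by rewrite -ltnS -(ltr_nat R) -natr1; lra.
Qed.

End Extremal.

Theorem theorem3p1 (R : realType) :
  (forall G : circular_arc_graph R,
    [/\ varrho G <> 1%N -> varrho G <> 2%N ->
          (((varrho G)%:R / 4)%:E <= delta G)%E /\
          (delta G <= (((varrho G)./2)%:R / 2 + 3 / 2)%:E)%E,
        varrho G = 1%N ->
          (0%:E <= delta G)%E /\ (delta G <= (3 / 2)%:E)%E &
        varrho G = 2%N ->
          (0%:E <= delta G)%E /\ (delta G <= 2%:E)%E]) /\
  (* sharpness of each of them, for every value of varrho *)
  [/\ forall n : nat, n <> 1%N -> n <> 2%N ->
        (exists G : circular_arc_graph R,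
           varrho G = n /\ delta G = (n%:R / 4)%:E) /\
        (exists G : circular_arc_graph R,
           varrho G = n /\ delta G = ((n./2)%:R / 2 + 3 / 2)%:E),
      (exists G : circular_arc_graph R, varrho G = 1%N /\ delta G = 0%:E) /\
      (exists G : circular_arc_graph R, varrho G = 1%N /\ delta G = (3 / 2)%:E) &
      (exists G : circular_arc_graph R, varrho G = 2%N /\ delta G = 0%:E) /\
      (exists G : circular_arc_graph R, varrho G = 2%N /\ delta G = 2%:E)].
Proof.
split=> [G|].
  have le := delta_le G; have ge0 := delta_ge0 G; split=> [v1 v2|v|v].
  - by split; first exact: delta_ge.
  - by split=> //; move: le; rewrite v mul0r add0r.
  - split=> //; move: le; rewrite v.
    by have -> : (2./2)%:R / 2 + 3 / 2 = 2 :> R by rewrite /=; lra.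
split=> [[|k] n1 n2||].
- split; first by exists point_graph; rewrite point_varrho point_delta mul0r.
  (* Every [extremal_graph] has positive [varrho], so the value [0] takes a graph of its own. *)
  by exists twin_path; rewrite twin_path_varrho twin_path_delta mul0r add0r.
- split.
    by exists (ring_graph k); rewrite ring_varrho ring_delta//; lia.
  by exists (extremal_graph k); rewrite extremal_varrho extremal_delta.
- split; first by exists (ring_graph 0); rewrite ring_varrho ring_delta1.
  exists (extremal_graph 0); rewrite extremal_varrho extremal_delta.
  by rewrite mul0r add0r.
- split; first by exists (ring_graph 1); rewrite ring_varrho ring_delta2.
  exists (extremal_graph 1); rewrite extremal_varrho extremal_delta.
  by have -> : (2./2)%:R / 2 + 3 / 2 = 2 :> R by rewrite /=; lra.
Qed.
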